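(* Let $d\ge 1$ and let $\Lambda=\{\lambda_1,\dots,\lambda_d\}\subset\mathbf{R}$ be a set of $d$ distinct real numbers. Then the map $\overline{f}\circ\pi:\mathcal{B}^\Lambda\to\overline{\mathcal{J}}^\Lambda$ is a homeomorphism, where $\mathcal{B}^\Lambda\subset\mathcal{W}$ carries the subspace topology and $\overline{\mathcal{J}}^\Lambda$ carries the Euclidean topology of matrix entries.
   Context: Write $[d]=\{1,\dots,d\}$. Coordinates. For non-empty $S\subseteq[d]$, $W^S=\{w:S\to\mathbf{R}\mid w\ne 0\}/\!\sim$, where $w\sim rw$ for non-zero real $r$ (a real projective space with its usual topology; points are written in homogeneous coordinates $w=(w_n)_{n\in S}$), and $W_+^S=\{w\in W^S\mid w_mw_n>0\ \forall m,n\in S\}$. An ordered partition of a set $S$ is a sequence $(S_1,\dots,S_r)$ of non-empty pairwise disjoint sets with union $S$; $\mathcal{P}_S$ is the set of these. $W_+^{(S_1,\dots,S_r)}=W_+^{S_1}\times\cdots\times W_+^{S_r}$, with elements written $w^{S_1}\oplus\cdots\oplus w^{S_r}$. $\overline{\mathcal{D}}^\Lambda$ is the disjoint union of the $W_+^{(S_1,\dots,S_r)}$ over $(S_1,\dots,S_r)\in\mathcal{P}_{[d]}$ (a factor $w^{S_i}$ represents the distribution $\sum_{n\in S_i}w^{S_i}_n\delta(\lambda-\lambda_n)$ up to scaling). The map $\overline f$. For non-empty $S\subseteq[d]$, $m=|S|$, $w\in W_+^S$, put $\langle p,q\rangle=\sum_{n\in S}w_n\,p(\lambda_n)q(\lambda_n)$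 for real polynomials $p,q$. Set $a_0=0$, $p_0=1$, $a_1=\langle 1,\lambda\rangle/\langle 1,1\rangle$, $p_1(\lambda)=\lambda-a_1$, and for $1\le n\le m-1$, $a_{2n}=\sqrt{\langle p_n,p_n\rangle/\langle p_{n-1},p_{n-1}\rangle}$, $a_{2n+1}=\langle p_n,\lambda p_n\rangle/\langle p_n,p_n\rangle$, $p_{n+1}(\lambda)=(\lambda-a_{2n+1})p_n(\lambda)-a_{2n}^2p_{n-1}(\lambda)$. Then $f(w)$ is the $m\times m$ symmetric tridiagonal matrix with diagonal $a_1,a_3,\dots,a_{2m-1}$ and next-to-diagonal entries $a_2,a_4,\dots,a_{2m-2}$ (independent of the representative of $w$). Set $\overline f(w^{S_1}\oplus\cdots\oplus w^{S_r})=f(w^{S_1})\oplus\cdots\oplus f(w^{S_r})$ (block diagonal matrix, blocks in this order). $\overline{\mathcal{J}}^\Lambda$ is the set of $d\times d$ real symmetric tridiagonal matrices with non-negative next-to-diagonal entries (equivalently direct sums of Jacobi matrices) having spectrum $\Lambda$. The set $\mathcal{B}^\Lambda$. Let $C_i^S=\prod_{n\in S}(\lambda_n-\lambda_i)^2$ for $S\subseteq[d]$, $i\in[d]$, with $C_i^\emptyset=1$. Let $\mathcal{W}=\prod_{\emptyset\ne S\subseteq[d]}W^S$, with coordinates $w^S=(w^S_n)_{n\in S}$ of $w\in\mathcal W$. $\mathcal{B}^\Lambda$ is the set of $w\in\mathcal{W}$ satisfying $C_i^{S-R}w_j^Rw_i^S=C_j^{S-R}w_i^Rw_j^S$ for all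 non-empty $R\subseteq S\subseteq[d]$ and $i,j\in R$, and $w_i^Sw_j^S\ge 0$ for all non-empty $S\subseteq[d]$ and $i,j\in S$. The map $\pi$. For $w\in\mathcal{B}^\Lambda$ and $n\in[d]$, let $\varphi_w(n)$ be the unique $S\subseteq[d]$ containing $n$ with $w_n^S\ne 0$ and such that $w_n^T\neq 0$ implies $|T|\le|S|$ for all $T\subseteq[d]$ containing $n$. The range of $\varphi_w$ is a chain $[d]=K_1\supset\cdots\supset K_r\ne\emptyset$. Let $(S_1,\dots,S_r)=(K_1-K_2,\dots,K_{r-1}-K_r,K_r)\in\mathcal{P}_{[d]}$ and $\pi(w)=(w_n^{K_1})_{n\in S_1}\oplus\cdots\oplus(w_n^{K_r})_{n\in S_r}\in W_+^{(S_1,\dots,S_r)}\subset\overline{\mathcal D}^\Lambda$. *)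

(* Defs.v *)
From HB Require Import structures.
From mathcomp Require Import all_boot all_order all_algebra.
From mathcomp Require Import all_classical reals topology normedtype.
Import numFieldNormedType.Exports.
Import Order.TTheory GRing.Theory Num.Theory.

Set Implicit Arguments.
Unset Strict Implicit.
Unset Printing Implicit Defensive.

Local Open Scope ring_scope.
Local Open Scope quotient_scope.

(* The finite index set [d] is 'I_d, so indices start
   at 0; its subsets are finite sets {set 'I_d} (delimiter %SET), as opposed to
   the Prop-valued sets of classical_sets (delimiter %classic). *)

Definition homeomorphism (X Y : topologicalType) (f : X -> Y) : Prop :=
  continuous f /\
  exists2 g : Y -> X, cancel f g /\ cancel g f & continuous g.

Section ProjectiveSpace.
Variables (R : realType) (d : nat) (S : {set 'I_d}).

Definition nzvec : Type :=
  set_type [set v : {ptws {n : 'I_d | n \in S} -> R} | v <> (fun=> 0)]%classic.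

HB.instance Definition _ := Topological.on nzvec.

Definition scal_rel (v w : nzvec) : bool :=
  `[< exists2 r : R, r != 0 & forall n, \val w n = r * \val v n >].

Lemma scal_rel_refl : reflexive scal_rel.
Proof. by move=> v; apply/asboolP; exists 1 => [|n]; rewrite ?oner_eq0 ?mul1r. Qed.

Lemma scal_rel_sym : symmetric scal_rel.
Proof.
suff H v w : scal_rel v w -> scal_rel w v by move=> v w; apply/idP/idP; exact: H.
move=> /asboolP[r r0 e]; apply/asboolP; exists r^-1; first by rewrite invr_eq0.
by move=> n; rewrite e mulKf.
Qed.

Lemma scal_rel_trans : transitive scal_rel.
Proof.
move=> v u w /asboolP[r r0 e] /asboolP[s s0 e']; apply/asboolP.
by exists (s * r) => [|n]; rewrite ?mulf_neq0 // e' e mulrA.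
Qed.

Canonical scal_equiv := EquivRel scal_rel scal_rel_refl scal_rel_sym scal_rel_trans.

Definition projW : Type := quotient_topology {eq_quot scal_equiv}.

HB.instance Definition _ := Topological.on projW.
HB.instance Definition _ := Quotient.on projW.

(* Coordinate of a vector at an arbitrary index, 0 outside S. *)
Definition vcoord (v : nzvec) (n : 'I_d) : R :=
  if insub n is Some n' then \val v n' else 0.

(* Homogeneous coordinates: those of a chosen representative.  They are defined
   up to a common non-zero factor only (see hcoord_pi), and every use below is
   invariant under such a factor. *)
Definition hcoord (w : projW) (n : 'I_d) : R := vcoord (repr w) n.

Lemma vcoord_out v n : n \notin S -> vcoord v n = 0.
Proof. by move=> nS; rewrite /vcoord insubN. Qed.

Lemma vcoord_neq0 v : exists2 n, n \in S & vcoord v n != 0.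
Proof.
apply: contrapT => H; case: v H => v v0 H.
have := set_mem v0; apply; apply/funext => n.
apply/eqP/negPn/negP => vn; apply: H; exists (\val n); first exact: valP.
by rewrite /vcoord valK.
Qed.

Lemma hcoord_neq0 w : exists2 n, n \in S & hcoord w n != 0.
Proof. exact: vcoord_neq0. Qed.

Lemma hcoord_pi v :
  exists2 r : R, r != 0 & forall n, hcoord (\pi_projW v) n = r * vcoord v n.
Proof.
have : v = repr (\pi_projW v) %[mod projW] by rewrite reprK.
move/eqmodP => /asboolP[r r0 e]; exists r => // n.
by rewrite /hcoord /vcoord; case: insubP => [n' _ _|_]; rewrite ?mulr0 ?e.
Qed.

Definition projW_pos : set projW :=
  [set w | forall m n, m \in S -> n \in S -> 0 < hcoord w m * hcoord w n]%classic.

(* The point with homogeneous coordinates (v_n)_(n in S). *)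
Lemma mkvec_subproof (v : 'I_d -> R) : (exists2 n, n \in S & v n != 0) ->
  ((fun n : {n | n \in S} => v (\val n)) : {ptws {n : 'I_d | n \in S} -> R}) \in
    [set v : {ptws {n : 'I_d | n \in S} -> R} | v <> (fun=> 0)]%classic.
Proof.
move=> [n nS vn]; apply/mem_set => /= /(congr1 (fun f => f (Sub n nS))) /=.
by apply/eqP.
Qed.

Definition mkvec (v : 'I_d -> R) (v0 : exists2 n, n \in S & v n != 0) : nzvec :=
  @exist _ (fun u => u \in _) _ (mkvec_subproof v0).

Definition mkprojW (v : 'I_d -> R) (v0 : exists2 n, n \in S & v n != 0) : projW :=
  \pi_projW (mkvec v0).

Lemma mkprojW_coord v (v0 : exists2 n, n \in S & v n != 0) :
  exists2 r : R, r != 0 & forall n, n \in S -> hcoord (mkprojW v0) n = r * v n.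
Proof.
have [r r0 e] := hcoord_pi (mkvec v0); exists r => // n nS.
by rewrite e /vcoord; case: insubP => [n' _ <-|]; rewrite ?nS.
Qed.

Lemma mkprojW_pos v (v0 : exists2 n, n \in S & v n != 0) :
  (forall m n, m \in S -> n \in S -> 0 < v m * v n) -> mkprojW v0 \in projW_pos.
Proof.
move=> vp; apply/mem_set => m n mS nS.
have [r r0 e] := mkprojW_coord v0; rewrite !e // mulrACA -expr2.
by rewrite mulr_gt0 ?vp // exprn_even_gt0.
Qed.

End ProjectiveSpace.

Arguments projW_pos R {d} S _.

Section OrderedPartitions.
Variables (R : realType) (d : nat).

(* Ordered partitions (S_1, ..., S_r) of [d]. *)
Record ordpart := OrdPart {
  npart : nat;
  part :> 'I_npart -> {set 'I_d};
  part_neq0 : forall k, part k != finset.set0;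
  part_disjoint : forall k l, k != l -> [disjoint part k & part l];
  part_cover : (\bigcup_(k < npart) part k = [set: 'I_d])%SET }.

Lemma ordpart_card (P : ordpart) : (\sum_(k < npart P) #|P k| = d)%N.
Proof.
rewrite -[RHS]card_ord -cardsT -(part_cover P).
pose F (k : 'I_(npart P)) := P k.
have tI : finset.trivIset [set F k | k : 'I_(npart P)]%SET.
  apply/finset.trivIsetP => _ _ /finset.imsetP[k _ ->] /finset.imsetP[l _ ->] kl.
  by apply: part_disjoint; apply: contra_neq kl => ->.
have Finj : injective F.
  move=> k l Fkl; apply/eqP/negPn/negP => /part_disjoint.
  rewrite -/(F k) -/(F l) -Fkl -finset.setI_eq0 finset.setIid; exact/negP/part_neq0.
have := tI; rewrite /finset.trivIset /finset.cover !big_imset /=; try by move=> ? ? _ _ /Finj.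
by move=> /eqP.
Qed.

(* The disjoint union, over the ordered partitions P of [d], of the products
   W_+^(S_1) x ... x W_+^(S_r). *)
Definition Dbar : Type :=
  {P : ordpart & forall k : 'I_(npart P), projW_pos R (P k)}.

End OrderedPartitions.

Section JacobiMatrices.
Variables (R : realType) (d : nat) (lam : 'I_d -> R).

Section OneBlock.
Variables (S : {set 'I_d}) (v : 'I_d -> R).

Definition inner (p q : {poly R}) : R :=
  \sum_(n in S) v n * p.[lam n] * q.[lam n].

Definition acoef_odd (p : {poly R}) : R := inner p ('X * p) / inner p p.

Definition acoef_even (p q : {poly R}) : R := Num.sqrt (inner p p / inner q q).

Fixpoint orthop (n : nat) {struct n} : {poly R} :=
  match n with
  | 0%N => 1
  | n1.+1 =>
    match n1 with
    | 0%N => 'X - (acoef_odd 1)%:P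
    | n2.+1 =>
      ('X - (acoef_odd (orthop n1))%:P) * orthop n1
      - (acoef_even (orthop n1) (orthop n2) ^+ 2)%:P * orthop n2
    end
  end.

(* a_(2n+1) for n >= 0 and a_(2n) for n >= 1; jacobi_even 0 is never used. *)
Definition jacobi_odd (n : nat) : R := acoef_odd (orthop n).
Definition jacobi_even (n : nat) : R := acoef_even (orthop n) (orthop n.-1).

Definition jacobi_mx : 'M[R]_#|S| :=
  \matrix_(i, j) if i == j then jacobi_odd i
                 else if j == i.+1 :> nat then jacobi_even j
                 else if i == j.+1 :> nat then jacobi_even i
                 else 0.
End OneBlock.

Lemma inner_scale (S : {set 'I_d}) (v : 'I_d -> R) r p q :
  inner S (fun n => r * v n) p q = r * inner S v p q.
Proof. by rewrite /inner mulr_sumr; apply: eq_bigr => n _; rewrite !mulrA. Qed.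

Lemma jacobi_mx_scale (S : {set 'I_d}) (v : 'I_d -> R) r : r != 0 ->
  jacobi_mx S (fun n => r * v n) = jacobi_mx S v.
Proof.
move=> r0; have e x y : (r * x) / (r * y) = x / y :> R.
  by rewrite invfM mulrACA divff ?mul1r.
have oE p : acoef_odd S (fun n => r * v n) p = acoef_odd S v p.
  by rewrite /acoef_odd !inner_scale e.
have eE p q : acoef_even S (fun n => r * v n) p q = acoef_even S v p q.
  by rewrite /acoef_even !inner_scale e.
have pE n : orthop S (fun n => r * v n) n = orthop S v n /\
            orthop S (fun n => r * v n) n.+1 = orthop S v n.+1.
  elim: n => [|n [IH1 IH2]]; first by rewrite /= oE.
  by split=> //; move: IH1 IH2 => /= -> ->; rewrite oE eE.
by apply/matrixP => i j; rewrite !mxE /jacobi_odd /jacobi_even !(pE _).1 oE !eE.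
Qed.

Definition fmap (S : {set 'I_d}) (w : projW_pos R S) : 'M[R]_#|S| :=
  jacobi_mx S (hcoord (\val w)).

Definition fbar (x : Dbar R d) : 'M[R]_d :=
  let P := projT1 x in
  castmx (ordpart_card P, ordpart_card P) (\mxdiag_(k < npart P) fmap (projT2 x k)).

Definition Jbar : set 'M[R]_d :=
  [set A | [/\ A^T = A,
               forall i j : 'I_d, (i.+1 < j)%N -> A i j = 0,
               forall i j : 'I_d, j = i.+1 :> nat -> 0 <= A i j &
               forall a : R, eigenvalue A a <-> exists n, a = lam n]]%classic.

End JacobiMatrices.

Section BSpace.
Variables (R : realType) (d : nat) (lam : 'I_d -> R).

(* Non-empty subsets of [d]. *)
Definition nset : Type := {S : {set 'I_d} | S != finset.set0}.

HB.instance Definition _ := Finite.on nset.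

Definition Wspace : Type := prod_topology (fun S : nset => projW R (\val S)).

HB.instance Definition _ := Topological.on Wspace.

Definition Ccoef (S : {set 'I_d}) (i : 'I_d) : R :=
  \prod_(n in S) (lam n - lam i) ^+ 2.

Definition Bset : set Wspace :=
  [set w | (forall T S : nset, \val T \subset \val S ->
              forall i j, i \in \val T -> j \in \val T ->
                Ccoef (\val S :\: \val T) i * hcoord (w T) j * hcoord (w S) i =
                Ccoef (\val S :\: \val T) j * hcoord (w T) i * hcoord (w S) j) /\
           (forall S : nset, forall i j, i \in \val S -> j \in \val S ->
                0 <= hcoord (w S) i * hcoord (w S) j)]%classic.

End BSpace.

Section PiMap.
Variables (R : realType) (d : nat) (lam : 'I_d -> R).

Definition is_phi (w : Wspace R d) (n : 'I_d) (S : nset d) : bool :=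
  [&& n \in \val S, hcoord (w S) n != 0 &
      [forall T : nset d,
        (n \in \val T) && (hcoord (w T) n != 0) ==> (#|\val T| <= #|\val S|)%N]].

Lemma nset1_subproof (n : 'I_d) : [set n]%SET != finset.set0.
Proof. by apply/finset.set0Pn; exists n; rewrite finset.in_set1. Qed.

Definition nset1 (n : 'I_d) : nset d := Sub [set n]%SET (nset1_subproof n).

(* The default value nset1 n is never used for w in Bset (see phiP). *)
Definition phi (w : Wspace R d) (n : 'I_d) : nset d :=
  odflt (nset1 n) [pick S | is_phi w n S].

(* The range K_1, ..., K_r of phi w, in decreasing order. *)
Definition phi_chain (w : Wspace R d) : seq (nset d) :=
  sort (fun S T : nset d => \val T \subset \val S) (enum [set phi w n | n : 'I_d]%SET).

Definition Kset (w : Wspace R d) (k : 'I_(size (phi_chain w))) : nset d :=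
  tnth (in_tuple (phi_chain w)) k.

(* S_k = K_k - K_(k+1) for k < r, and S_r = K_r. *)
Definition Kpart (w : Wspace R d) (k : 'I_(size (phi_chain w))) : {set 'I_d} :=
  (\val (Kset k) :\: nth finset.set0 (map \val (phi_chain w)) k.+1)%SET.

Hypothesis lam_inj : injective lam.

Lemma Ccoef_neq0 (S : {set 'I_d}) i : i \notin S -> Ccoef lam S i != 0.
Proof.
move=> iS; apply/prodf_neq0 => n nS; rewrite expf_neq0 // subr_eq0.
by apply: contraNneq iS => /lam_inj <-.
Qed.

Section OnB.
Variables (w : Wspace R d) (Bw : Bset lam w).

(* A coordinate non-zero at T is still non-zero at S as soon as w^S does not
   vanish identically on T. *)
Lemma B_extend (T S : nset d) i k : \val T \subset \val S ->
  i \in \val T -> k \in \val T -> hcoord (w S) k != 0 ->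
  hcoord (w T) i != 0 -> hcoord (w S) i != 0.
Proof.
move=> TS iT kT wk wi; apply: contraTneq isT => wi0.
have := Bw.1 T S TS i k iT kT; rewrite wi0 mulr0 => /esym/eqP.
by rewrite !mulf_eq0 (negPf wk) (negPf wi) (negPf (Ccoef_neq0 _)) // finset.in_setD kT.
Qed.

Lemma nsetU_subproof (S T : nset d) : (\val S :|: \val T)%SET != finset.set0.
Proof.
have /finset.set0Pn[x xS] := valP S; apply/finset.set0Pn; exists x.
by rewrite finset.in_setU xS.
Qed.

Lemma B_join (S T : nset d) n m :
  is_phi w n S -> m \in \val T -> hcoord (w T) m != 0 ->
  \val T \subset \val S \/
  (exists U : nset d, [/\ \val T \subset \val U, \val S \proper \val U
     & hcoord (w U) m != 0]).
Proof.
move=> /and3P[nS wn /forallP maxS] mT wm.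
pose U : nset d := Sub (\val S :|: \val T)%SET (nsetU_subproof S T).
have SU : \val S \subset \val U by rewrite SubK finset.subsetUl.
have TU : \val T \subset \val U by rewrite SubK finset.subsetUr.
have nU := fintype.subsetP SU n nS.
case: (boolP (\val U \subset \val S)) => [US|nUS].
  by left; apply: fintype.subset_trans US.
have SpU : \val S \proper \val U by rewrite properE SU.
right; exists U; split => //.
have wnU : hcoord (w U) n == 0.
  apply: contraT => wnU; have := maxS U; rewrite nU wnU /=.
  by rewrite leqNgt proper_card.
have [k kU wk] := hcoord_neq0 (w U).
have UE x : x \in \val U = (x \in \val S) || (x \in \val T).
  by rewrite SubK finset.in_setU.
move: (kU); rewrite UE => /orP[kS|kT].
  by have := B_extend SU nS kS wk wn; rewrite wnU.
exact: B_extend TU mT kT wk wm.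
Qed.

Lemma is_phi_sub (S T : nset d) n : is_phi w n S ->
  n \in \val T -> hcoord (w T) n != 0 -> \val T \subset \val S.
Proof.
move=> pS nT wT; have [//|[U [TU SU wU]]] := B_join pS nT wT.
case/and3P: pS => _ _ /forallP/(_ U).
by rewrite (fintype.subsetP TU) // wU /= leqNgt proper_card.
Qed.

Lemma phi_exists n : exists S, is_phi w n S.
Proof.
pose Q (S : nset d) := (n \in \val S) && (hcoord (w S) n != 0).
have Q1 : Q (nset1 n).
  apply/andP; split; first by rewrite SubK finset.in_set1.
  have [k k1 wk] := hcoord_neq0 (w (nset1 n)).
  have kn : k = n by move: k1; rewrite SubK finset.in_set1 => /eqP.
  by move: wk; rewrite kn.
case: (@arg_maxnP _ (nset1 n) Q (fun S => #|\val S|) Q1) => S /andP[nS wS] mS.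
by exists S; rewrite /is_phi nS wS; apply/forallP => T; apply/implyP => /mS.
Qed.

Lemma is_phi_uniq n S T : is_phi w n S -> is_phi w n T -> S = T.
Proof.
move=> pS pT; apply/val_inj/eqP; rewrite finset.eqEsubset.
have /and3P[nS wS _] := pS; have /and3P[nT wT _] := pT.
by rewrite (is_phi_sub pT nS wS) (is_phi_sub pS nT wT).
Qed.

Lemma phiP n : is_phi w n (phi w n).
Proof.
rewrite /phi; case: pickP => [//|H].
by have [S] := phi_exists n; rewrite H.
Qed.

Lemma phi_unique n S : is_phi w n S <-> S = phi w n.
Proof. by split=> [pS|->]; [apply: is_phi_uniq pS _|]; exact: phiP. Qed.

Lemma mem_phi n : n \in \val (phi w n).
Proof. by case/and3P: (phiP n). Qed.

Lemma phi_total n m :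
  (\val (phi w n) \subset \val (phi w m)) || (\val (phi w m) \subset \val (phi w n)).
Proof.
have /and3P[mT wm /forallP maxm] := phiP m.
have [->|[U [TU SU wU]]] := B_join (phiP n) mT wm; first by rewrite orbT.
have := is_phi_sub (phiP m) (fintype.subsetP TU _ mT) wU => Um.
by rewrite (fintype.subset_trans (fintype.proper_sub SU) Um).
Qed.

Lemma phi_sub n m : n \in \val (phi w m) -> \val (phi w n) \subset \val (phi w m).
Proof.
move=> nm; have /and3P[nn wn _] := phiP n; have /and3P[mm wm _] := phiP m.
have [//|mn] := orP (phi_total n m).
exact: is_phi_sub (phiP m) (fintype.subsetP mn _ mm) (B_extend mn mm nm wn wm).
Qed.

Lemma mem_phi_chain S : reflect (exists n, S = phi w n) (S \in phi_chain w).
Proof.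
rewrite mem_sort mem_enum; apply: (iffP finset.imsetP) => [[n _ ->]|[n ->]]; by exists n.
Qed.

Lemma phi_chain_proper (k l : 'I_(size (phi_chain w))) : (k < l)%N ->
  \val (Kset l) \proper \val (Kset k).
Proof.
move=> kl; pose x0 := Kset k.
have srt : sorted (fun S T : nset d => \val T \subset \val S) (phi_chain w).
  apply: (@sort_sorted_in _ (mem (phi_chain w))).
    by move=> _ _ /mem_phi_chain[n ->] /mem_phi_chain[m ->]; exact: phi_total.
  by apply/allP => S; rewrite -(mem_sort (fun S T : nset d => \val T \subset \val S)).
have tr : transitive (fun S T : nset d => \val T \subset \val S).
  by move=> T S U TS UT; apply: fintype.subset_trans UT TS.
have := sorted_ltn_nth tr x0 srt k l (ltn_ord k) (ltn_ord l) kl.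
rewrite /Kset !(tnth_nth x0) /= => sub; rewrite finset.properEneq sub andbT.
have u : uniq (phi_chain w) by rewrite sort_uniq enum_uniq.
rewrite (inj_eq val_inj) nth_uniq //; by rewrite gtn_eqF.
Qed.

Lemma Kset_mem (k : 'I_(size (phi_chain w))) : Kset k \in phi_chain w.
Proof. exact: mem_tnth. Qed.

Lemma Kpart_mem (k : 'I_(size (phi_chain w))) n : (n \in Kpart k) = (phi w n == Kset k).
Proof.
have next' (l : 'I_(size (phi_chain w))) : l = k.+1 :> nat ->
    nth finset.set0 [seq \val i | i <- phi_chain w] k.+1 = \val (Kset l).
  by move=> <-; rewrite (nth_map (Kset k)) // [Kset l]/Kset (tnth_nth (Kset k)).
have next x : x \in nth finset.set0 [seq \val i | i <- phi_chain w] k.+1 ->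
    exists2 l : 'I_(size (phi_chain w)), l = k.+1 :> nat & x \in \val (Kset l).
  case: (ltnP k.+1 (size (phi_chain w))) => [k1|k1]; last first.
    by rewrite nth_default ?size_map // inE.
  by exists (Ordinal k1) => //; rewrite -(next' (Ordinal k1)).
rewrite finset.in_setD; apply/andP/eqP => [[nk1 nk]|e].
  have /mem_phi_chain[m em] := Kset_mem k.
  have sub : \val (phi w n) \subset \val (Kset k) by rewrite em phi_sub // -em.
  have : phi w n \in phi_chain w by apply/mem_phi_chain; exists n.
  move=> /(@tnthP _ _ (in_tuple (phi_chain w)))[l el].
  have {}el : phi w n = Kset l by [].
  case: (ltngtP k l) => [kl|lk|/val_inj kl]; last by rewrite el kl.
  - have k1 : (k.+1 < size (phi_chain w))%N by apply: leq_ltn_trans kl _.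
    move: nk1; rewrite (next' (Ordinal k1)) //.
    have -> //: n \in \val (Kset (Ordinal k1)).
    have := mem_phi n; rewrite el.
    move: kl; rewrite leq_eqVlt => /orP[/eqP kl|kl].
      by have -> : Ordinal k1 = l by exact: val_inj.
    by move/(fintype.subsetP (fintype.proper_sub (@phi_chain_proper (Ordinal k1) l kl))).
  - by have := phi_chain_proper lk; rewrite -el properE sub andbF.
split; last by rewrite -e mem_phi.
apply/negP => /next[l lk nl].
have kl : (k < l)%N by rewrite lk.
have /mem_phi_chain[m em] := Kset_mem l.
have := phi_chain_proper kl; rewrite -e properE => /andP[_ /negP]; apply.
by rewrite em phi_sub // -em.
Qed.

Lemma Kpart_neq0 k : Kpart (w := w) k != finset.set0.
Proof.
have /mem_phi_chain[m em] := Kset_mem k.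
by apply/finset.set0Pn; exists m; rewrite Kpart_mem em.
Qed.

Lemma Kset_inj : injective (@Kset w).
Proof.
move=> k l kl; case: (ltngtP k l) => [h|h|/val_inj //];
  by have := phi_chain_proper h; rewrite kl fintype.properxx.
Qed.

Lemma Kpart_disjoint k l : k != l -> [disjoint Kpart (w := w) k & Kpart l].
Proof.
move=> kl; rewrite -finset.setI_eq0; apply/eqP/finset.setP => n.
rewrite finset.in_setI finset.in_set0 !Kpart_mem.
by apply: contra_neqF kl => /andP[/eqP-> /eqP/Kset_inj].
Qed.

Lemma Kpart_cover : (\bigcup_(k < size (phi_chain w)) Kpart k = [set: 'I_d])%SET.
Proof.
apply/finset.setP => n; rewrite finset.in_setT; apply/finset.bigcupP.
have : phi w n \in phi_chain w by apply/mem_phi_chain; exists n.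
move=> /(@tnthP _ _ (in_tuple (phi_chain w)))[l el].
by exists l => //; rewrite Kpart_mem el.
Qed.

Definition pi_part : ordpart d := OrdPart Kpart_neq0 Kpart_disjoint Kpart_cover.

Lemma Kpart_coord k n : n \in Kpart (w := w) k -> hcoord (w (Kset k)) n != 0.
Proof. by rewrite Kpart_mem => /eqP <-; case/and3P: (phiP n). Qed.

Lemma Kpart_nz k : exists2 n, n \in Kpart (w := w) k & hcoord (w (Kset k)) n != 0.
Proof.
by have /finset.set0Pn[n nk] := Kpart_neq0 k; exists n => //; exact: Kpart_coord.
Qed.

Lemma Kpart_pos k m n : m \in Kpart (w := w) k -> n \in Kpart k ->
  0 < hcoord (w (Kset k)) m * hcoord (w (Kset k)) n.
Proof.
move=> mk nk; rewrite lt_neqAle eq_sym mulf_neq0 ?Kpart_coord //=.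
by apply: Bw.2; [move: mk|move: nk]; rewrite finset.in_setD => /andP[].
Qed.

Definition pi_fun (k : 'I_(npart pi_part)) : projW_pos R (pi_part k) :=
  @exist _ (fun x => x \in _) (mkprojW (Kpart_nz k)) (mkprojW_pos (Kpart_nz k) (@Kpart_pos k)).

End OnB.

Definition pimap (w : Bset lam) : Dbar R d :=
  existT _ (@pi_part (\val w) (set_valP w)) (@pi_fun (\val w) (set_valP w)).

End PiMap.

(* Main.v *)
From HB Require Import structures.
Require Import Defs.
From mathcomp Require Import all_boot all_order all_algebra.
From mathcomp Require Import all_classical reals topology normedtype.
From mathcomp Require Import ring zify.
Import numFieldNormedType.Exports.
Import Order.TTheory GRing.Theory Num.Theory.

(** Neither the map fbar \o pi nor its inverse is handled by formulas.  Both
    spaces are presented as quotients of one compact space Z, with the same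
    identifications.

    A tridiagonal matrix J with spectrum lam is determined by an orthonormal
    basis q_0, ..., q_(d-1) of the space of functions on the spectrum, through
    J a b = sum_n lam_n q_a(n) q_b(n): the row q_a is the vector e_a written in
    an eigenbasis of J, so it is known up to a sign at each eigenvalue.  A point
    of Z consists of such a basis q together with, for each index set T, a unit
    vector x^T supported on T and lying in the span of the first d - #|T| + 1
    rows q_b, such that the squares (x^T_n)^2 satisfy the equations of B.  Each
    condition is closed and all coordinates are in [-1, 1], so Z is compact.
    There are two continuous maps on Z,

      [res_B] : (q, x) |-> ([(x^T_n)^2]_(n in T))_T   to B,
      [res_J] : (q, x) |-> the matrix J of q          to the Jacobi matrices.

    Call a tail the set K_a of the indices where q_b vanishes for all b < a.
    If J splits above the row a, then the span of q_0, ..., q_(a-1) consists of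
    all functions vanishing on K_a, so #|K_a| = d - a and the support
    conditions leave only x^(K_a) = +- q_a ([resolution_tail]).  Hence:
    - the squares of x determine J: in a block each q_a is obtained from its
      predecessors by the three-term recurrence, and at the start of a block
      it is the vector of a tail ([resolution_jac]);
    - J determines the products q_a(n) q_b(n), by Lagrange interpolation at the
      eigenvalues, hence the squares of x at the tails, and the equations of B
      propagate these to the other index sets ([resolution_sq]).

    The map [res_J] is onto since a symmetric matrix with spectrum lam has an
    orthonormal eigenbasis ([Jbar_frame]) and every frame extends to a
    resolution ([resolution_exists]).  Given w in B, the orthonormal
    polynomials of the factors of pi(w), weighted by the square roots of the
    masses and placed one block after the other, form a frame whose matrix is
    fbar (pi w), and the resolution extending it is mapped to w
    ([pimap_resolution]).  So [res_B] is onto and fbar \o pi carries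
    [res_B] z to [res_J] z.  A map between Hausdorff spaces
    induced in this way by two continuous surjections from a compact space with
    the same fibres is a homeomorphism ([homeomorphism_factor]). *)

Set Implicit Arguments.
Unset Strict Implicit.
Unset Printing Implicit Defensive.

Local Open Scope ring_scope.

(** * Orthonormal frames putting multiplication by lambda in tridiagonal form *)

Section Frames.
Variables (R : realType) (d : nat) (lam : 'I_d -> R).
Hypothesis lam_inj : injective lam.
Implicit Types (q : 'I_d -> 'I_d -> R) (T : {set 'I_d}) (p : {poly R}).

Definition jac q (a b : 'I_d) : R := \sum_n lam n * (q a n * q b n).

(** With J the matrix of entries [jac q a b], these conditions say that the
    rows q_a are the standard basis vectors written in an orthonormal
    eigenbasis of J, and that J is a direct sum of Jacobi matrices. *)
Definition frame q : Prop :=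
  [/\ forall a b, \sum_n q a n * q b n = (a == b)%:R,
      forall a b : 'I_d, (a.+1 < b)%N -> jac q a b = 0 &
      forall a b : 'I_d, b = a.+1 :> nat -> 0 <= jac q a b].

Lemma jac_sym q a b : jac q a b = jac q b a.
Proof. by apply: eq_bigr => n _; rewrite [q a n * _]mulrC. Qed.

Lemma orthonormal_tr q :
  (forall a b, \sum_n q a n * q b n = (a == b)%:R) ->
  forall m n, \sum_a q a m * q a n = (m == n)%:R.
Proof.
move=> qO m n; pose Q : 'M[R]_d := \matrix_(a, k) q a k.
have QQ : Q *m Q^T = 1%:M.
  by apply/matrixP => a b; rewrite !mxE -qO; apply: eq_bigr => k _; rewrite !mxE.
have /matrixP/(_ m n) := mulmx1C QQ; rewrite !mxE => <-.
by apply: eq_bigr => k _; rewrite !mxE.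
Qed.

Lemma orthonormal_expand q :
  (forall a b, \sum_n q a n * q b n = (a == b)%:R) ->
  forall (u : 'I_d -> R) n, u n = \sum_a (\sum_m u m * q a m) * q a n.
Proof.
move=> qO u n; under eq_bigr do rewrite mulr_suml.
rewrite exchange_big /=; under eq_bigr do
  (under eq_bigr do rewrite -mulrA; rewrite -mulr_sumr (orthonormal_tr qO)).
rewrite (bigD1 n) //= eqxx mulr1 big1 ?addr0 // => m /negPf ->.
by rewrite mulr0.
Qed.

Lemma frame_mul q : frame q ->
  forall a n, lam n * q a n = \sum_c jac q a c * q c n.
Proof.
case=> qO _ _ a n; rewrite [LHS](orthonormal_expand qO (fun n => lam n * q a n)).
by apply: eq_bigr => c _; congr (_ * _); apply: eq_bigr => m _; rewrite mulrA.
Qed.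

(** The moments determine a function on a finite set of nodes: test against
    Lagrange polynomials. *)
Lemma poly_moments_eq0 (u : 'I_d -> R) :
  (forall k, \sum_n lam n ^+ k * u n = 0) -> forall n, u n = 0.
Proof.
move=> u0 n; pose p : {poly R} := \prod_(l | l != n) ('X - (lam l)%:P).
have pu : \sum_m p.[lam m] * u m = 0.
  under eq_bigr do rewrite horner_coef mulr_suml.
  rewrite exchange_big big1 // => i _.
  by under eq_bigr do rewrite -mulrA; rewrite -mulr_sumr u0 mulr0.
have pE m : p.[lam m] = \prod_(l | l != n) (lam m - lam l).
  by rewrite horner_prod; apply: eq_bigr => l _; rewrite !hornerE.
move: pu; rewrite (bigD1 n) //= [X in _ + X]big1 ?addr0.
  move/eqP; rewrite mulf_eq0 => /orP[|/eqP //].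
  suff /negPf -> : p.[lam n] != 0 by [].
  rewrite pE; apply/prodf_neq0 => l ln.
  by rewrite subr_eq0 (inj_eq lam_inj) eq_sym.
by move=> m mn; rewrite pE (bigD1 m) //= subrr !mul0r.
Qed.

Definition moment q k (a b : 'I_d) : R := \sum_n lam n ^+ k * (q a n * q b n).

Lemma momentS q k a b : frame q ->
  moment q k.+1 a b = \sum_c jac q a c * moment q k c b.
Proof.
move=> fq; under [RHS]eq_bigr do rewrite mulr_sumr.
rewrite exchange_big /=; apply: eq_bigr => n _.
rewrite exprSr -mulrA [lam n * _]mulrA (frame_mul fq) mulr_suml mulr_sumr.
by apply: eq_bigr => c _; rewrite -!mulrA mulrCA.
Qed.

Lemma moment0 q a b : frame q -> moment q 0 a b = (a == b)%:R.
Proof. by case=> qO _ _; rewrite -qO; apply: eq_bigr => n _; rewrite mul1r. Qed.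

(** The products q_a(n) q_b(n) are the entries of the spectral projections of
    J; they are recovered from their moments, the entries of the powers of J. *)
Lemma jac_products q q' : frame q -> frame q' ->
  (forall a b, jac q a b = jac q' a b) ->
  forall a b n, q a n * q b n = q' a n * q' b n.
Proof.
move=> fq fq' J a b n; apply/eqP; rewrite -subr_eq0; apply/eqP.
apply: (@poly_moments_eq0 (fun n => q a n * q b n - q' a n * q' b n)) => k.
under eq_bigr do rewrite mulrBr.
rewrite sumrB -/(moment q k a b) -/(moment q' k a b).
suff -> : moment q k a b = moment q' k a b by rewrite subrr.
elim: k a => [|k IH] a; first by rewrite !moment0.
by rewrite !momentS //; apply: eq_bigr => c _; rewrite J IH.
Qed.

Lemma moment_deg q k (a b : 'I_d) : frame q -> (a + k < b)%N -> moment q k a b = 0.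
Proof.
move=> fq; elim: k a => [|k IH] a; first by
  rewrite addn0 => ab; rewrite moment0 // -val_eqE ltn_eqF.
move=> akb; rewrite momentS // big1 // => c _.
case: (ltnP a.+1 c) => ac; first by case: fq => _ -> //; rewrite mul0r.
by rewrite IH ?mulr0 //; apply: leq_ltn_trans akb; rewrite addnS -addSn leq_add2r.
Qed.

(** Each multiplication by lambda moves a row of a frame by at most one row. *)
Lemma poly_moment_deg q p (a b : 'I_d) : frame q -> (a + size p <= b)%N ->
  \sum_n p.[lam n] * q a n * q b n = 0.
Proof.
move=> fq spb; under eq_bigr do rewrite -mulrA horner_coef mulr_suml.
rewrite exchange_big big1 // => i _.
under eq_bigr do rewrite -mulrA.
rewrite -mulr_sumr -/(moment q i a b) moment_deg ?mulr0 //.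
by apply: leq_trans spb; rewrite ltn_add2l.
Qed.

(** The matrix of q is a direct sum of a block of size a and a block of size
    d - a. *)
Definition cut q (a : nat) : Prop :=
  forall b c : 'I_d, (b < a)%N -> (a <= c)%N -> jac q b c = 0.

Definition tail q (a : nat) : {set 'I_d} :=
  [set n | [forall b : 'I_d, (b < a)%N ==> (q b n == 0)]]%SET.

Lemma tailP q a n :
  reflect (forall b : 'I_d, (b < a)%N -> q b n = 0) (n \in tail q a).
Proof.
rewrite inE; apply: (iffP forallP) => h b.
  by move=> ba; have /implyP/(_ ba)/eqP := h b.
by apply/implyP => /h ->.
Qed.

(** The span of the rows before a cut is stable under multiplication by
    lambda, so all the moments of q_b q_c vanish. *)
Lemma cut_disjoint q a (b c : 'I_d) n : frame q -> cut q a -> (b < a)%N -> (a <= c)%N ->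
  q b n * q c n = 0.
Proof.
move=> fq ca ba ac.
apply: (@poly_moments_eq0 (fun n => q b n * q c n)) => k; rewrite -/(moment q k b c).
elim: k b ba => [|k IH] b ba.
  by rewrite moment0 // -val_eqE ltn_eqF //; apply: leq_trans ac.
rewrite momentS // big1 // => e _; case: (ltnP e a) => ea; last by rewrite ca ?mul0r.
by rewrite IH ?mulr0.
Qed.

(** By [cut_disjoint] each column of q is concentrated either before or after
    the cut; as the columns are unit vectors, the sum of the squares of the
    entries of the first a rows, which is a, counts the columns off the tail. *)
Lemma card_tail q a : frame q -> cut q a -> (a <= d)%N -> #|tail q a| = (d - a)%N.
Proof.
move=> fq ca ad; have [qO _ _] := fq.
suff aE : (a%:R : R) = #|~: tail q a|%:R.
  by move/eqP: aE; rewrite eqr_nat => /eqP aE; rewrite finset.cardsCs card_ord -aE.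
have -> : (a%:R : R) = \sum_(b < d | (b < a)%N) \sum_n q b n * q b n.
  under eq_bigr do rewrite qO eqxx.
  rewrite sumr_const; congr (_%:R); rewrite -sum1_card.
  by rewrite -(big_ord_widen _ (fun=> 1%N) ad) sum_nat_const card_ord muln1.
rewrite exchange_big /= -sumr_const [RHS]big_mkcond /=; apply: eq_bigr => n _.
rewrite finset.in_setC; case: tailP => [nt|nt] /=.
  by rewrite big1 // => b /nt ->; rewrite mul0r.
have [b0 b0a qb0] : exists2 b : 'I_d, (b < a)%N & q b n != 0.
  apply: contrapT => h; apply: nt => b ba; apply: contrapT => /eqP qb.
  by apply: h; exists b.
have <- : \sum_b q b n * q b n = 1 by rewrite (orthonormal_tr qO) eqxx.
rewrite [RHS](bigID (fun b : 'I_d => (b < a)%N)) /= [X in _ + X]big1 ?addr0 //.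
move=> c; rewrite -leqNgt => ac; have /eqP := cut_disjoint n fq ca b0a ac.
by rewrite mulf_eq0 (negPf qb0) /= => /eqP ->; rewrite mul0r.
Qed.

(** The leading row of T singles out the block of J that governs the
    coordinates indexed by T. *)
Definition leads q T (a : 'I_d) : Prop :=
  (exists2 n, n \in T & q a n != 0) /\ T \subset tail q a.

Lemma leads_exists q T : frame q -> T != finset.set0 -> exists a, leads q T a.
Proof.
move=> [qO _ _] /finset.set0Pn[n0 n0T].
have [a0 qa0] : exists a0, q a0 n0 != 0.
  apply: contrapT => h; have := orthonormal_tr qO n0 n0.
  rewrite eqxx big1 => [/eqP|a _]; first by rewrite eq_sym oner_eq0.
  by case: (eqVneq (q a n0) 0) => [->|qa]; [rewrite mul0r|case: h; exists a].
pose Q (a : 'I_d) := [exists n in T, q a n != 0].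
have Q0 : Q a0 by apply/existsP; exists n0; rewrite n0T.
case: (@arg_minnP _ a0 Q (fun a => a : nat) Q0) => a /existsP[n /andP[nT qn]] mina.
exists a; split; first by exists n.
apply/fintype.subsetP => m mT; apply/tailP => b ba; apply/eqP; apply: contraT => qb.
have : Q b by apply/existsP; exists m; rewrite mT.
by move/mina; rewrite leqNgt ba.
Qed.

(** If the row a - 1 were linked to the row a, then the recurrence would express
    q_a on T by lambda q_(a-1) and earlier rows, all vanishing on T. *)
Lemma leads_cut q T a : frame q -> leads q T a -> cut q a.
Proof.
move=> fq [[n nT qa] /fintype.subsetP/(_ n nT)/tailP tn] b c ba ac.
have [_ qT _] := fq.
case: (ltnP b.+1 c) => [/qT //|cb].
have {cb ba}[ca ba] : c = a :> nat /\ a = b.+1 :> nat by lia.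
rewrite (val_inj ca) {c ac ca}; apply/eqP.
have /esym/eqP := frame_mul fq b n; rewrite tn ?ba // mulr0 (bigD1 a) //= big1.
  by rewrite addr0 mulf_eq0 (negPf qa) orbF.
move=> c; rewrite -val_eqE /= => ca.
case: (ltngtP c a) ca => // ca _; first by rewrite tn ?mulr0.
by rewrite qT ?mul0r // -ba.
Qed.

End Frames.

(** * Resolutions: a frame together with one vector for each index set *)

Section Resolutions.
Variables (R : realType) (d : nat) (lam : 'I_d -> R).
Hypothesis lam_inj : injective lam.
Implicit Types (q : 'I_d -> 'I_d -> R) (x : nset d -> 'I_d -> R) (T S : nset d).

(** In a resolution, x^T is a unit vector supported on T in the span of the
    rows q_0, ..., q_(d - #|T|); when J is a single Jacobi matrix it is
    proportional to q_0 times the polynomial whose roots are the eigenvalues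
    of index outside T. The last condition is the system of equations of B for
    the squares. *)
Definition resolution q x : Prop :=
  [/\ frame lam q,
      forall T n, n \notin \val T -> x T n = 0,
      forall T, \sum_n x T n ^+ 2 = 1,
      forall T (b : 'I_d), (d < b + #|\val T|)%N -> \sum_n x T n * q b n = 0 &
      forall T S, \val T \subset \val S -> forall i j, i \in \val T -> j \in \val T ->
        Ccoef lam (\val S :\: \val T) i * x T j ^+ 2 * x S i ^+ 2 =
        Ccoef lam (\val S :\: \val T) j * x T i ^+ 2 * x S j ^+ 2].

(** A vector supported on the tail is orthogonal to the rows before a, and
    #|T| = d - a makes x^T orthogonal to the rows after a. *)
Lemma resolution_tail q x (a : 'I_d) T : resolution q x -> cut lam q a ->
  \val T = tail q a -> forall n, x T n ^+ 2 = q a n ^+ 2.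
Proof.
move=> [fq x0 x1 xq _] ca Ta n; have [qO _ _] := fq.
have cT : #|\val T| = (d - a)%N by rewrite Ta (card_tail lam_inj fq ca) // ltnW.
have xE m : x T m = (\sum_n x T n * q a n) * q a m.
  rewrite [LHS](orthonormal_expand qO (x T)) (bigD1 a) //= [X in _ + X]big1 ?addr0 //.
  move=> b; rewrite -val_eqE /= => ba.
  case: (ltngtP b a) ba => // ba _; last first.
    by rewrite xq ?mul0r //; have := ltn_ord a; lia.
  rewrite big1 ?mul0r // => k _; case: (boolP (k \in \val T)) => kT; last first.
    by rewrite x0 ?mul0r.
  by move: kT; rewrite Ta => /tailP ->; rewrite ?mulr0.
set t := \sum_n _ in xE.
suff t1 : t ^+ 2 = 1 by rewrite xE exprMn t1 mul1r.
rewrite -(x1 T); under [RHS]eq_bigr do rewrite xE exprMn.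
rewrite -mulr_sumr (eq_bigr (fun n => q a n * q a n)) ?qO ?eqxx ?mulr1 //.
Qed.

(** The three-term recurrence, with all earlier rows kept in the sum so that
    the first row needs no separate treatment. *)
Lemma frame_step q (p a : 'I_d) n : frame lam q -> a = p.+1 :> nat ->
  lam n * q p n - \sum_(c < d | (c < a)%N) jac lam q p c * q c n = jac lam q p a * q a n.
Proof.
move=> fq ap; have [_ qT _] := fq.
rewrite (frame_mul fq) (bigID (fun c : 'I_d => (c < a)%N)) /= addrAC subrr add0r.
rewrite (bigD1 a) /= ?ltnn // big1 ?addr0 // => c; rewrite -leqNgt => /andP[ac].
by rewrite -val_eqE /= => ca; rewrite qT ?mul0r //; lia.
Qed.

(** Induction on the rows shows that the products q_b(n) q_c(n) depend only on
    the squares of x; unlike the rows themselves, these products are free of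
    the sign ambiguity. *)
Lemma resolution_jac q x q' x' : resolution q x -> resolution q' x' ->
  (forall T n, x T n ^+ 2 = x' T n ^+ 2) -> forall a b, jac lam q a b = jac lam q' a b.
Proof.
move=> Z Z' xx.
suff H : forall a, (a <= d)%N -> forall b c : 'I_d, (b < a)%N -> (c < a)%N ->
    forall n, q b n * q c n = q' b n * q' c n.
  by move=> a b; apply: eq_bigr => n _; rewrite (H d).
have [fq _ _ _ _] := Z; have [fq' _ _ _ _] := Z'.
have [qO qT qP] := fq; have [qO' qT' qP'] := fq'.
elim=> [//|a IH] ad; have {}IH := IH (ltnW ad).
pose A := Ordinal ad.
have JE (b c : 'I_d) : (b < a)%N -> (c < a)%N -> jac lam q b c = jac lam q' b c.
  by move=> ba ca; apply: eq_bigr => n _; rewrite IH.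
suff H n : q A n * q A n = q' A n * q' A n /\
    forall c : 'I_d, (c < a)%N -> q A n * q c n = q' A n * q' c n.
  have AE (b : 'I_d) : (b < a.+1)%N -> b = A \/ (b < a)%N.
    by rewrite ltnS leq_eqVlt => /orP[/eqP ba|]; [left; apply: ord_inj|right].
  move=> b c /AE[->|ba] /AE[->|ca] n; have [HA Hc] := H n => //; first exact: Hc.
    by rewrite mulrC [RHS]mulrC; exact: Hc.
  exact: IH.
(* When nothing links q_a to its predecessors it is the vector of the tail. *)
have Hcut : cut lam q A -> cut lam q' A -> q A n * q A n = q' A n * q' A n /\
    forall c : 'I_d, (c < a)%N -> q A n * q c n = q' A n * q' c n.
  move=> cA cA'; split; last first.
    move=> c ca; rewrite mulrC [RHS]mulrC.
    by rewrite (cut_disjoint lam_inj _ fq cA) // (cut_disjoint lam_inj _ fq' cA').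
  have tE : tail q A = tail q' A.
    apply/finset.setP => m; apply/tailP/tailP => h b ba; apply/eqP;
      have /eqP := IH b b ba ba m; rewrite h // mul0r; last rewrite eq_sym;
      by rewrite ?[0 == _]eq_sym mulf_eq0 orbb.
  have nz : tail q A != finset.set0.
    by rewrite -card_gt0 (card_tail lam_inj fq cA) ?subn_gt0 // ltnW.
  pose T : nset d := Sub (tail q A) nz.
  have TE : \val T = tail q A by rewrite SubK.
  rewrite -!expr2 -(resolution_tail Z cA TE) xx.
  by rewrite (resolution_tail Z' cA') // TE.
case: (posnP a) => [a0|a_gt0]; first by apply: Hcut => b c; rewrite /= a0.
pose p : 'I_d := Ordinal (leq_ltn_trans (leq_pred a) ad).
have pa : (p < a)%N by rewrite /= prednK.
have Ap : A = p.+1 :> nat by rewrite /= prednK.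
pose r n := lam n * q p n - \sum_(c < d | (c < A)%N) jac lam q p c * q c n.
pose r' n := lam n * q' p n - \sum_(c < d | (c < A)%N) jac lam q' p c * q' c n.
have rE m : r m = jac lam q p A * q A m by apply: frame_step.
have rE' m : r' m = jac lam q' p A * q' A m by apply: frame_step.
have rq m (c : 'I_d) : (c < a)%N -> r m * q c m = r' m * q' c m.
  move=> ca; rewrite /r /r' !mulrBl -!mulrA IH //; congr (_ - _).
  rewrite !mulr_suml; apply: eq_bigr => e ea.
  by rewrite -!mulrA IH // JE.
(* r is a multiple of q_a, and its norm is the link from p to a. *)
have rr m : r m * r m = r' m * r' m.
  rewrite {1}/r {2}/r' !mulrBl -!mulrA [q p m * _]mulrC [q' p m * _]mulrC rq //.
  congr (_ - _); rewrite !mulr_suml; apply: eq_bigr => e ea.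
  by rewrite -!mulrA [q e m * _]mulrC [q' e m * _]mulrC rq // JE.
have sumr (q0 : 'I_d -> 'I_d -> R) (s : R) (r0 : 'I_d -> R) :
    (forall a b, \sum_n q0 a n * q0 b n = (a == b)%:R) ->
    (forall m, r0 m = s * q0 A m) -> \sum_m r0 m * r0 m = s ^+ 2.
  move=> O E; under eq_bigr do rewrite E mulrACA.
  by rewrite -mulr_sumr O eqxx mulr1.
have sE : jac lam q p A = jac lam q' p A.
  apply/eqP; rewrite -(@eqrXn2 _ 2) ?qP ?qP' //.
  rewrite -(sumr _ _ _ qO rE) -(sumr _ _ _ qO' rE').
  by apply/eqP/eq_bigr => m _.
case: (eqVneq (jac lam q p A) 0) => [s0|s0].
  have link (q0 : 'I_d -> 'I_d -> R) : frame lam q0 -> jac lam q0 p A = 0 -> cut lam q0 A.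
    move=> [_ qT0 _] s00 b c bA Ac.
    case: (ltnP b.+1 c) => [/qT0 //|cb].
    have /andP[/eqP bp /eqP cA] : (b == p) && (c == A).
      by rewrite -!val_eqE /=; move: bA Ac cb => /=; lia.
    by rewrite bp cA.
  by apply: Hcut; apply: link; rewrite // -sE.
split=> [|c ca]; apply: (mulfI s0).
  apply: (mulfI s0); move: (rr n); rewrite rE rE' -sE.
  by rewrite mulrACA [in RHS]mulrACA -!mulrA.
by move: (rq n c ca); rewrite rE rE' -sE -!mulrA.
Qed.

Lemma proportional_uniq (T : {set 'I_d}) (u u' g : 'I_d -> R) :
  (forall i j, i \in T -> j \in T -> g i * u j = g j * u i) ->
  (forall i j, i \in T -> j \in T -> g i * u' j = g j * u' i) ->
  (exists2 i, i \in T & g i != 0) ->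
  \sum_(n in T) u n = \sum_(n in T) u' n -> \sum_(n in T) u n != 0 ->
  forall n, n \in T -> u n = u' n.
Proof.
move=> gu gu' [i iT gi] uu su n nT; set s := \sum_(n in T) u n in uu su.
have h (v : 'I_d -> R) : (forall i j, i \in T -> j \in T -> g i * v j = g j * v i) ->
    s = \sum_(n in T) v n -> (\sum_(n in T) g n) * v i = g i * s.
  by move=> gv ->; rewrite mulr_suml mulr_sumr; apply: eq_bigr => j jT; rewrite -gv.
have e := h u gu erefl; have e' := h u' gu' uu.
have G0 : \sum_(n in T) g n != 0.
  by apply: contra_neq su => G; move/eqP: e; rewrite G mul0r eq_sym mulf_eq0 (negPf gi) => /eqP.
have ui : u i = u' i by apply: (mulfI G0); rewrite e e'.
by apply: (mulfI gi); rewrite gu // gu' // ui.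
Qed.

Lemma nset_tail q (a : 'I_d) T : leads q (\val T) a ->
  exists K : nset d, \val K = tail q a.
Proof.
move=> [[n nT _] /fintype.subsetP tT].
have nz : tail q a != finset.set0 by apply/finset.set0Pn; exists n; exact: tT.
by exists (Sub (tail q a) nz); rewrite SubK.
Qed.

(** The equation of B for the inclusion of T in the tail of its leading row,
    where x is known by [resolution_tail]. *)
Lemma resolution_leads q x T a : resolution q x -> leads q (\val T) a ->
  forall i j, i \in \val T -> j \in \val T ->
  Ccoef lam (tail q a :\: \val T) i * q a i ^+ 2 * x T j ^+ 2 =
  Ccoef lam (tail q a :\: \val T) j * q a j ^+ 2 * x T i ^+ 2.
Proof.
move=> Z la i j iT jT; have [K KE] := nset_tail la.
have [fq _ _ _ xB] := Z.
have qx := resolution_tail Z (leads_cut fq la) KE.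
by rewrite mulrAC [RHS]mulrAC -!qx -KE; apply: xB => //; rewrite KE; case: la.
Qed.

Lemma resolution_sumT q x T : resolution q x -> \sum_(n in \val T) x T n ^+ 2 = 1.
Proof.
case=> _ x0 x1 _ _; rewrite -(x1 T) [RHS](bigID (mem (\val T))) /= [X in _ + X]big1 ?addr0 //.
by move=> n nT; rewrite x0 // expr0n.
Qed.

(** The leading row of T and its tail are read off from the products of
    [jac_products], and [resolution_leads] then gives the squares of x^T up to
    a common factor, fixed by the norm. *)
Lemma resolution_sq q x q' x' : resolution q x -> resolution q' x' ->
  (forall a b, jac lam q a b = jac lam q' a b) -> forall T n, x T n ^+ 2 = x' T n ^+ 2.
Proof.
move=> Z Z' J T n.
have [fq x0 _ _ _] := Z; have [fq' x0' _ _ _] := Z'.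
case: (boolP (n \in \val T)) => nT; last by rewrite x0 ?x0'.
have qq := jac_products lam_inj fq fq' J.
have q0 b m : (q b m == 0) = (q' b m == 0).
  by rewrite -[LHS]orbb -mulf_eq0 qq mulf_eq0 orbb.
have tE a : tail q a = tail q' a.
  apply/finset.setP => m; apply/tailP/tailP => h b ba; apply/eqP; have /eqP := h b ba;
    by rewrite q0.
have [a la] := leads_exists fq (valP T).
have la' : leads q' (\val T) a.
  by move: la; rewrite /leads tE => -[[m mT qm] t]; split => //; exists m; rewrite -?q0.
have h' := resolution_leads Z' la'.
apply: (@proportional_uniq (\val T) (fun n => x T n ^+ 2) (fun n => x' T n ^+ 2)
  (fun n => Ccoef lam (tail q a :\: \val T) n * q a n ^+ 2)) => //.
- exact: resolution_leads.
- by move=> i j iT jT; rewrite tE !expr2 !qq -!expr2 h'.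
- have [[m mT qm] _] := la; exists m => //; rewrite mulf_neq0 ?expf_neq0 //.
  by apply: Ccoef_neq0 => //; rewrite finset.in_setD mT.
- by rewrite (resolution_sumT _ Z) (resolution_sumT _ Z').
- by rewrite (resolution_sumT _ Z) oner_neq0.
Qed.

Definition annihilate (D : {set 'I_d}) (u : 'I_d -> R) (n : 'I_d) : R :=
  (\prod_(l in D) (lam n - lam l)) * u n.

Lemma sqr_prod_Ccoef (D : {set 'I_d}) n :
  (\prod_(l in D) (lam n - lam l)) ^+ 2 = Ccoef lam D n.
Proof. by rewrite -prodrXl; apply: eq_bigr => l _; rewrite -sqrrN opprB. Qed.

(** Take x^T proportional to the leading row of T multiplied by the polynomial
    vanishing on the part of its tail outside T. The degree of that polynomial
    is d - a - #|T|, which gives the required orthogonality. In the equation of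
    B for T in S, either both sets have the same leading row and the two
    polynomials differ by the factor indexed by S - T, or x^S vanishes on T and
    both sides are 0. *)
Lemma resolution_exists q : frame lam q -> exists x, resolution q x /\
  forall T, exists2 a, leads q (\val T) a &
    exists2 c, c != 0 & forall n, x T n = c * annihilate (tail q a :\: \val T) (q a) n.
Proof.
move=> fq; have [qO _ _] := fq.
have H T : exists u : 'I_d -> R, \sum_n u n ^+ 2 = 1 /\ exists2 a, leads q (\val T) a &
    exists2 c, c != 0 & forall n, u n = c * annihilate (tail q a :\: \val T) (q a) n.
  have [a la] := leads_exists fq (valP T).
  pose g := annihilate (tail q a :\: \val T) (q a).
  have s0 : 0 < \sum_n g n ^+ 2.
    have [[n nT qn] _] := la.
    rewrite (bigD1 n) //= ltr_pwDl ?sumr_ge0 // => [|m _]; last exact: sqr_ge0.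
    rewrite exprn_even_gt0 //= mulf_neq0 //; apply/prodf_neq0 => l.
    rewrite finset.in_setD subr_eq0 (inj_eq lam_inj) => /andP[lT _].
    by apply: contraNneq lT => <-.
  have r0 : Num.sqrt (\sum_n g n ^+ 2) != 0 by rewrite sqrtr_eq0 -ltNge.
  exists (fun n => (Num.sqrt (\sum_n g n ^+ 2))^-1 * g n); split.
    under eq_bigr do rewrite exprMn.
    by rewrite -mulr_sumr exprVn sqr_sqrtr ?ltW // mulVf // gt_eqF.
  by exists a => //; exists (Num.sqrt (\sum_n g n ^+ 2))^-1; rewrite ?invr_eq0.
have [x xP] := boolp.choice H; exists x; split; last by move=> T; case: (xP T).
split=> //.
- move=> T n nT; have [_ [a la [c c0 ->]]] := xP T.
  case: (boolP (n \in tail q a)) => na.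
    by rewrite /annihilate (bigD1 n) ?finset.in_setD ?nT //= subrr !mul0r mulr0.
  suff qn : q a n = 0 by rewrite /annihilate qn !mulr0.
  apply/eqP; apply: contraNT na => qn; apply/tailP => b ba; apply/eqP.
  have /eqP := cut_disjoint lam_inj n fq (leads_cut fq la) ba (leqnn a).
  by rewrite mulf_eq0 (negPf qn) orbF.
- by move=> T; case: (xP T).
- move=> T b Tb; have [_ [a la [c c0 xE]]] := xP T.
  pose p : {poly R} := \prod_(l in tail q a :\: \val T) ('X - (lam l)%:P).
  under eq_bigr => n _.
    rewrite xE /annihilate (_ : \prod_(l in _) _ = p.[lam n]); last first.
      by rewrite horner_prod; apply: eq_bigr => l _; rewrite !hornerE.
    rewrite -mulrA; over.
  rewrite -mulr_sumr poly_moment_deg ?mulr0 // /p -big_enum size_prod_XsubC -cardE.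
  have ct := card_tail lam_inj fq (leads_cut fq la) (ltnW (ltn_ord a)).
  have [_ ta] := la; have := finset.cardsD (tail q a) (\val T).
  rewrite (finset.setIidPr ta) => ->.
  by have := subset_leq_card ta; have := ltn_ord a; rewrite ct; lia.
- move=> T S TS i j iT jT.
  have [_ [a la [c c0 xT]]] := xP T; have [_ [b lb [e e0 xS]]] := xP S.
  have [[n nT qn] ta] := la; have [[m mS qm] tb] := lb.
  case: (ltngtP b a) => [ba|ab|/val_inj ab].
  + have x0 k : k \in \val T -> x S k = 0.
      by move=> /(fintype.subsetP ta)/tailP kt; rewrite xS /annihilate kt ?mulr0.
    by rewrite !x0 // expr0n !mulr0.
  + by move: qn; rewrite (tailP _ _ _ (fintype.subsetP tb _ (fintype.subsetP TS _ nT))) ?eqxx.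
  subst b.
  have split_diff k : Ccoef lam (tail q a :\: \val T) k =
      Ccoef lam (tail q a :\: \val S) k * Ccoef lam (\val S :\: \val T) k.
    rewrite {1}/Ccoef (bigID (mem (\val S))) /= mulrC; congr (_ * _); apply: eq_bigl => l;
      rewrite !finset.in_setD.
    * case: (boolP (l \in \val S)) => lS; rewrite ?andbF ?andbT //=.
      by case: (boolP (l \in \val T)) => // /(fintype.subsetP TS); rewrite (negPf lS).
    * case: (boolP (l \in \val S)) => lS; rewrite ?andbF ?andbT //=.
      by rewrite (fintype.subsetP tb _ lS) andbT.
  by rewrite !xT !xS /annihilate !exprMn !sqr_prod_Ccoef !split_diff; ring.
Qed.

(** Eigenvectors for distinct eigenvalues of a symmetric matrix are
    orthogonal; the frame is the transpose of the eigenbasis. *)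
Lemma Jbar_frame (J : 'M[R]_d) : Jbar lam J ->
  exists2 q, frame lam q & forall a b, jac lam q a b = J a b.
Proof.
move=> [Jsym Jtri Jpos Jeig].
have H n : exists v : 'rV[R]_d, v *m J = lam n *: v /\ \sum_a v 0 a ^+ 2 = 1.
  have /eigenvalueP[v vJ v0] : eigenvalue J (lam n) by apply/Jeig; exists n.
  have s0 : 0 < \sum_a v 0 a ^+ 2.
    rewrite lt_neqAle sumr_ge0 ?andbT => [|a _]; last exact: sqr_ge0.
    apply: contra_neq v0 => /esym/eqP; rewrite psumr_eq0 => [/allP h|a _]; last exact: sqr_ge0.
    apply/rowP => a; apply/eqP; rewrite mxE.
    by have := h a (mem_index_enum a); rewrite expf_eq0.
  exists ((Num.sqrt (\sum_a v 0 a ^+ 2))^-1 *: v); split.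
    by rewrite -scalemxAl vJ !scalerA mulrC.
  under eq_bigr do rewrite mxE exprMn.
  by rewrite -mulr_sumr exprVn sqr_sqrtr ?ltW // mulVf // gt_eqF.
have [v vP] := boolp.choice H.
have vJ n b : \sum_c v n 0 c * J c b = lam n * v n 0 b.
  by have [/rowP/(_ b)] := vP n; rewrite !mxE.
have vO m n : \sum_a v m 0 a * v n 0 a = (m == n)%:R.
  case: eqVneq => [->|mn].
    by have [_ <-] := vP n; apply: eq_bigr => a _; rewrite expr2.
  have e : lam m * (\sum_a v m 0 a * v n 0 a) = lam n * (\sum_a v m 0 a * v n 0 a).
    rewrite [RHS]mulr_sumr; under [RHS]eq_bigr do rewrite mulrCA -vJ mulr_sumr.
    rewrite exchange_big mulr_sumr /=; apply: eq_bigr => b _.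
    rewrite mulrA -vJ mulr_suml; apply: eq_bigr => c _.
    by rewrite -[in LHS]Jsym mxE; ring.
  apply/eqP; move/eqP: e; rewrite -subr_eq0 -mulrBl mulf_eq0 subr_eq0 (inj_eq lam_inj).
  by rewrite (negPf mn).
pose q a n := v n 0 a.
have qO a b : \sum_n q a n * q b n = (a == b)%:R.
  exact: (orthonormal_tr (q := fun n a => v n 0 a) vO).
have qJ a b : jac lam q a b = J a b.
  rewrite /jac /q; under eq_bigr do rewrite mulrCA -vJ mulr_sumr.
  rewrite exchange_big /= (bigD1 a) //= [X in _ + X]big1 ?addr0.
    by under eq_bigr do rewrite mulrA; rewrite -mulr_suml -/q qO eqxx mul1r.
  by move=> c ca; under eq_bigr do rewrite mulrA; rewrite -mulr_suml qO eq_sym (negPf ca) mul0r.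
by exists q => //; split=> // a b ab; rewrite qJ; [exact: Jtri|exact: Jpos].
Qed.

Lemma jac_Jbar q : frame lam q -> Jbar lam (\matrix_(a, b) jac lam q a b).
Proof.
move=> fq; have [qO qT qP] := fq; set J := \matrix_(a, b) _.
have Jv (v : 'rV[R]_d) n :
    \sum_b (v *m J) 0 b * q b n = lam n * \sum_a v 0 a * q a n.
  under eq_bigr do rewrite mxE mulr_suml.
  rewrite exchange_big mulr_sumr /=; apply: eq_bigr => a _.
  rewrite mulrCA (frame_mul fq) mulr_sumr; apply: eq_bigr => b _.
  by rewrite mxE mulrA.
split.
- by apply/matrixP => a b; rewrite !mxE jac_sym.
- by move=> a b ab; rewrite mxE qT.
- by move=> a b ab; rewrite mxE qP.
move=> t; split=> [/eigenvalueP[v vJ v0]|[n ->]].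
  have [n un] : exists n, \sum_a v 0 a * q a n != 0.
    apply: contrapT => h; move/eqP: v0; apply; apply/rowP => a; rewrite mxE.
    rewrite (orthonormal_expand (q := fun n a => q a n) (orthonormal_tr qO) (v 0)).
    rewrite big1 // => n _; case: (eqVneq (\sum_b v 0 b * q b n) 0) => [->|]; first by rewrite mul0r.
    by move=> un; case: h; exists n.
  exists n; apply: (mulIf un); rewrite -Jv vJ mulr_sumr.
  by apply: eq_bigr => b _; rewrite mxE mulrA.
apply/eigenvalueP; exists (\row_a q a n).
  apply/rowP => b; rewrite !mxE frame_mul //; apply: eq_bigr => a _.
  by rewrite !mxE mulrC jac_sym.
apply: contra_neq (@oner_neq0 R) => /rowP h.
have -> : 1 = \sum_a q a n * q a n by rewrite (orthonormal_tr qO) eqxx.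
apply: big1 => a _; by have := h a; rewrite !mxE => ->; rewrite mul0r.
Qed.

End Resolutions.

(** * Topological preliminaries *)

Section Topology.
Local Open Scope classical_set_scope.

Lemma compact_set_type (X : topologicalType) (A : set X) :
  compact A -> compact [set: A].
Proof.
move=> cA F PF _.
have FA : (\val @ F) A.
  by apply: (@filterS _ F _ setT (\val @^-1` A)) => [a _|]; [exact: (set_valP a)|exact: filterT].
have [p [Ap clp]] := cA _ _ FA.
exists (exist _ p (mem_set Ap)); split=> // B C FB.
case=> _ /= [[W oW <-]] Wp WC.
have [|_ [[b Bb <-] Wb]] := clp (\val @` B) W _ (open_nbhs_nbhs (conj oW Wp)).
  by apply: (@filterS _ F _ B _ _ FB) => b Bb; exists b.
by exists b; split => //; apply: WC.
Qed.

Lemma separated_hausdorff (K : realType) (X : topologicalType) :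
  (forall p q : X, p <> q -> exists2 f : X -> K, continuous f & f p <> f q) ->
  hausdorff_space X.
Proof.
move=> sep p q cl; apply: contrapT => /sep[f cf]; apply.
apply: (@norm_hausdorff K K) => A B /cf Ap /cf Bq.
by have [x [Ax Bx]] := cl _ _ Ap Bq; exists (f x).
Qed.

(** The preimage of a closed set D is the image under al of the compact set
    be^-1(D). *)
Lemma continuous_factor (X Y1 Y2 : topologicalType)
    (al : X -> Y1) (be : X -> Y2) (F : Y1 -> Y2) :
  compact [set: X] -> hausdorff_space Y1 -> continuous al -> continuous be ->
  (forall y, exists x, al x = y) -> (forall x, F (al x) = be x) -> continuous F.
Proof.
move=> cX hY ca cb sa Fab; apply/continuous_closedP => D cD.
have -> : F @^-1` D = al @` (be @^-1` D).
  apply/seteqP; split=> y; last by move=> [x Dx <-]; rewrite /preimage /= Fab.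
  by have [x <-] := sa y; rewrite /preimage /= Fab => Dx; exists x.
apply: compact_closed hY _; apply: continuous_compact; first exact: continuous_subspaceT.
apply: subclosed_compact cX _ => //.
by move/continuous_closedP: cb; apply.
Qed.

Lemma homeomorphism_factor (X Y1 Y2 : topologicalType)
    (al : X -> Y1) (be : X -> Y2) (F : Y1 -> Y2) :
  compact [set: X] -> hausdorff_space Y1 -> hausdorff_space Y2 ->
  continuous al -> continuous be ->
  (forall y, exists x, al x = y) -> (forall y, exists x, be x = y) ->
  (forall x x', be x = be x' -> al x = al x') ->
  (forall x, F (al x) = be x) -> homeomorphism F.
Proof.
move=> cX h1 h2 ca cb sa sb ba Fab; have [s sK] := boolp.choice sb.
have Gbe x : al (s (be x)) = al x by apply: ba.
split; first exact: continuous_factor ca cb sa Fab.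
exists (fun y => al (s y)); last exact: continuous_factor cb ca sb Gbe.
split=> y; last by rewrite Fab.
by have [x <-] := sa y; rewrite Fab.
Qed.

Lemma continuous_mx (K : realType) m n (X : topologicalType) (f : X -> 'M[K]_(m, n)) :
  (forall i j, continuous (fun x => f x i j)) -> continuous f.
Proof.
move=> cf x U [P nP PU].
have H : \forall y \near x, forall ij : 'I_m * 'I_n, P ij.1 ij.2 (f y ij.1 ij.2).
  by apply: filter_forall => -[i j] /=; exact: cf (nP i j).
by apply: filterS H => y Py; apply: PU => i j; exact: (Py (i, j)).
Qed.

Lemma continuous_prod (X : topologicalType) (I : Type) (K : I -> topologicalType)
    (f : X -> prod_topology K) :
  (forall i, continuous (fun x => f x i)) -> continuous f.
Proof.
move=> cf x; apply/cvg_sup => i U [V] [[W oW <-]] Wfx WU.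
apply: (@filterS _ (f @ x) _ _ _ WU); apply: cf.
exact: open_nbhs_nbhs.
Qed.

Lemma continuous_sumr (K : realType) (X : topologicalType) (I : Type) (r : seq I)
    (P : pred I) (f : I -> X -> K) :
  (forall i, continuous (f i)) -> continuous (fun x => \sum_(i <- r | P i) f i x).
Proof. by move=> cf; apply: continuous_big => // -[a b]; exact: add_continuous. Qed.

Lemma continuous_mulr (K : realType) (X : topologicalType) (f g : X -> K) :
  continuous f -> continuous g -> continuous (fun x => f x * g x).
Proof. by move=> cf cg x; apply: continuousM; [exact: cf|exact: cg]. Qed.

Lemma continuous_sqr (K : realType) (X : topologicalType) (f : X -> K) :
  continuous f -> continuous (fun x => f x ^+ 2).
Proof. by move=> cf; under eq_fun do rewrite expr2; exact: continuous_mulr. Qed.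

Lemma closed_eqr (K : realType) (X : topologicalType) (f g : X -> K) :
  continuous f -> continuous g -> closed [set x | f x = g x].
Proof.
move=> cf cg; rewrite (_ : mkset _ = (fun x => f x - g x) @^-1` [set t | t = 0]).
  apply: preimage_closed => [x _|]; last exact: closed_eq.
  by apply: (@continuousB _ K) => //; [exact: cf|exact: cg].
by apply/seteqP; split=> x /= /eqP e; apply/eqP; move: e; rewrite subr_eq0.
Qed.

Lemma closed_ge0 (K : realType) (X : topologicalType) (f : X -> K) :
  continuous f -> closed [set x | 0 <= f x].
Proof. move=> cf; rewrite (_ : mkset _ = f @^-1` [set t | 0 <= t]) //.
by apply: preimage_closed => [x _|]; [exact: cf|exact: closed_ge]. Qed.

Lemma closed_forall (X : topologicalType) (I : Type) (P : I -> X -> Prop) :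
  (forall i, closed [set x | P i x]) -> closed [set x | forall i, P i x].
Proof.
move=> cP; rewrite (_ : mkset _ = \bigcap_(i in setT) [set x | P i x]).
  exact: closed_bigI.
by apply/seteqP; split=> x /=; [move=> h i _; exact: h|move=> h i; exact: h].
Qed.

End Topology.

(** * Projective spaces: equality of points, separation *)

Section ProjectiveSpace.
Variables (R : realType) (d : nat) (S : {set 'I_d}).
Implicit Types w : projW R S.

Lemma hcoord_val w (n : {n | n \in S}) : hcoord w (\val n) = \val (repr w) n.
Proof. by rewrite /hcoord /vcoord valK. Qed.

Lemma projW_eq w w' :
  (forall i j, i \in S -> j \in S ->
    hcoord w i * hcoord w' j = hcoord w j * hcoord w' i) -> w = w'.
Proof.
move=> h; have [j jS wj] := hcoord_neq0 w.
have wj' : hcoord w' j != 0.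
  have [i iS wi] := hcoord_neq0 w'; have := mulf_neq0 wj wi.
  by rewrite -h // mulf_eq0 negb_or => /andP[].
rewrite -[w]reprK -[w']reprK; apply/eqmodP/asboolP.
exists (hcoord w' j / hcoord w j) => [|n]; first by rewrite mulf_neq0 ?invr_eq0.
rewrite -!hcoord_val mulrAC; apply: (canRL (mulfK wj)).
by rewrite mulrC -h ?(valP n) // mulrC.
Qed.

Lemma mkprojW_eq (v : 'I_d -> R) (v0 : exists2 n, n \in S & v n != 0) w :
  (forall i j, i \in S -> j \in S -> v i * hcoord w j = v j * hcoord w i) ->
  mkprojW v0 = w.
Proof.
move=> h; apply: projW_eq => i j iS jS; have [r _ e] := mkprojW_coord v0.
by rewrite !e // -!mulrA h.
Qed.

Lemma mkprojW_inj_sum (v v' : 'I_d -> R) (v0 : exists2 n, n \in S & v n != 0)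
    (v0' : exists2 n, n \in S & v' n != 0) : mkprojW v0 = mkprojW v0' ->
  \sum_(n in S) v n = 1 -> \sum_(n in S) v' n = 1 -> forall n, n \in S -> v n = v' n.
Proof.
move=> vv s1 s1' n nS.
have [r r0 e] := mkprojW_coord v0; have [r' r0' e'] := mkprojW_coord v0'.
have rv m : m \in S -> r * v m = r' * v' m by move=> mS; rewrite -e // -e' // vv.
have rr : r = r'.
  by rewrite -[r]mulr1 -[r']mulr1 -{1}s1 -s1' !mulr_sumr; exact: eq_bigr.
by apply: (mulfI r0); rewrite rv // rr.
Qed.

Let sqnorm (v : nzvec R S) : R := \sum_n vcoord v n ^+ 2.

Lemma sqnorm_neq0 v : sqnorm v != 0.
Proof.
have [n nS vn] := vcoord_neq0 v; rewrite /sqnorm psumr_neq0 => [|m _]; last exact: sqr_ge0.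
by apply/hasP; exists n; rewrite ?mem_index_enum //= exprn_even_gt0.
Qed.

Lemma vcoord_continuous n : continuous (fun v : nzvec R S => vcoord v n).
Proof.
rewrite /vcoord; case: insubP => [n' _ _|_]; last exact: cst_continuous.
move=> v; apply: (@continuous_comp _ _ _ (\val : nzvec R S -> _) (fun u => u n')).
  exact: initial_continuous.
exact: (@proj_continuous _ (fun _ : {n | n \in S} => R)).
Qed.

(** The entries of the orthogonal projection onto the line spanned by a vector
    are continuous functions on projective space that separate points. *)
Lemma projW_hausdorff : hausdorff_space (projW R S).
Proof.
apply: (@separated_hausdorff R) => w w' ww'.
pose g (i j : 'I_d) (v : nzvec R S) := vcoord v i * vcoord v j * (sqnorm v)^-1.
have cg i j : continuous (g i j : nzvec R S -> R).
  apply: continuous_mulr; first by apply: continuous_mulr; exact: vcoord_continuous.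
  move=> v; apply: continuousV; first exact: sqnorm_neq0.
  by apply: continuous_sumr => n; apply: continuous_sqr; exact: vcoord_continuous.
have gE i j : {homo g i j : a b / (\pi_(projW R S) a == \pi_(projW R S) b)%qT >-> a == b}.
  move=> a b /eqP/eqmodP/asboolP[r r0 e].
  have vE n : vcoord b n = r * vcoord a n.
    by rewrite /vcoord; case: insubP => *; rewrite ?mulr0.
  apply/eqP; rewrite /g /sqnorm !vE; under [in RHS]eq_bigr do rewrite vE exprMn.
  by rewrite -mulr_sumr; field; rewrite r0 -/(sqnorm a) sqnorm_neq0.
have [i [j ij]] : exists i j, g i j (repr w) <> g i j (repr w').
  apply: contrapT => h; apply: ww'; apply: projW_eq => i j _ _.
  have E k l : g k l (repr w) = g k l (repr w') by apply: contrapT => e; apply: h; exists k, l.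
  have [m mS wm] := hcoord_neq0 w.
  have n0 := sqnorm_neq0 (repr w); have n0' := sqnorm_neq0 (repr w').
  set s := sqnorm (repr w) in n0; set s' := sqnorm (repr w') in n0'.
  have H k l : hcoord w k * hcoord w l * s' = hcoord w' k * hcoord w' l * s.
    have := E k l; rewrite /g -/s -/s' -!/(hcoord _ _) => e.
    transitivity (hcoord w k * hcoord w l / s * (s * s')); first by field.
    by rewrite e; field.
  have wm' : hcoord w' m != 0.
    have := mulf_neq0 (mulf_neq0 wm wm) n0'; rewrite H.
    by rewrite !mulf_eq0 !negb_or => /andP[/andP[]].
  (* Proportionality of w_i and w_j follows by comparing both with the coordinate m. *)
have c0 := mulf_neq0 (mulf_neq0 wm n0') (mulf_neq0 wm' n0).
  apply: (mulIf c0).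
  transitivity (hcoord w i * hcoord w m * s' * (hcoord w' j * hcoord w' m * s)); first by ring.
  by rewrite (H i m) -(H j m); ring.
exists (g i j \o repr) => //.
exact: (@repr_comp_continuous _ _ _ (g i j) (cg i j) (gE i j)).
Qed.

End ProjectiveSpace.

(** * The compact space of resolutions *)

Section ResolutionSpace.
Variables (R : realType) (d : nat) (lam : 'I_d -> R).
Hypothesis lam_inj : injective lam.

Definition res_coord : Type := ('I_d * 'I_d + nset d * 'I_d)%type.

HB.instance Definition _ := Finite.on res_coord.

(** A resolution is stored as the family of all its entries, in a product of
    copies of the real line, so that Tychonoff's theorem applies. *)
Definition res_ambient : Type := prod_topology (fun _ : res_coord => R).

HB.instance Definition _ := Topological.on res_ambient.

Implicit Types z : res_ambient.

Definition frame_of z (a n : 'I_d) : R := z (inl (a, n)).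
Definition vectors_of z (T : nset d) (n : 'I_d) : R := z (inr (T, n)).

Definition resolutions : set res_ambient :=
  [set z | resolution lam (frame_of z) (vectors_of z)]%classic.

Lemma frame_of_continuous a n : continuous (fun z => frame_of z a n).
Proof. exact: (@proj_continuous _ (fun _ : res_coord => R)). Qed.

Lemma vectors_of_continuous T n : continuous (fun z => vectors_of z T n).
Proof. exact: (@proj_continuous _ (fun _ : res_coord => R)). Qed.

Lemma jac_continuous a b : continuous (fun z => jac lam (frame_of z) a b).
Proof.
apply: continuous_sumr => n; apply: continuous_mulr; first exact: cst_continuous.
by apply: continuous_mulr; exact: frame_of_continuous.
Qed.

Lemma resolutions_closed : closed resolutions.
Proof.
have cst (t : R) : continuous (fun _ : res_ambient => t) by exact: cst_continuous.
have cF := frame_of_continuous; have cX := vectors_of_continuous; have cJ := jac_continuous.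
rewrite (_ : resolutions =
  ([set z | forall a b, \sum_n frame_of z a n * frame_of z b n = (a == b)%:R] `&`
   [set z | forall a b : 'I_d, (a.+1 < b)%N -> jac lam (frame_of z) a b = 0] `&`
   [set z | forall a b : 'I_d, b = a.+1 :> nat -> 0 <= jac lam (frame_of z) a b] `&`
   [set z | forall (T : nset d) n, n \notin \val T -> vectors_of z T n = 0] `&`
   [set z | forall T : nset d, \sum_n vectors_of z T n ^+ 2 = 1] `&`
   [set z | forall (T : nset d) (b : 'I_d), (d < b + #|\val T|)%N ->
     \sum_n vectors_of z T n * frame_of z b n = 0] `&`
   [set z | forall T S : nset d, \val T \subset \val S ->
     forall i j, i \in \val T -> j \in \val T ->
        Ccoef lam (\val S :\: \val T) i * vectors_of z T j ^+ 2 * vectors_of z S i ^+ 2 =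
        Ccoef lam (\val S :\: \val T) j * vectors_of z T i ^+ 2 * vectors_of z S j ^+ 2])%classic);
  last by apply/seteqP; split=> z; [case=> -[? ? ?]|move=> [[[[[[]]]]]]].
by do ![apply: closedI]; do ![apply: closed_forall => ?]; (apply: closed_eqr || apply: closed_ge0);
  rewrite // ?expr2; do ![apply: continuous_sumr => ? | apply: continuous_mulr | apply: continuous_sqr].
Qed.

Lemma sqr_le_sum (u : 'I_d -> R) n : \sum_m u m ^+ 2 = 1 -> -1 <= u n <= 1.
Proof.
move=> u1; rewrite -ler_norml -[`|_|]ger0_norm // -(ler_sqr (normr_ge0 _) ler01) //.
rewrite normr_id expr1n -u1 (bigD1 n) //= real_normK ?num_real // lerDl.
by apply: sumr_ge0 => m _; exact: sqr_ge0.
Qed.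

Lemma resolutions_compact : compact resolutions.
Proof.
have box := @tychonoff res_coord (fun=> R) (fun=> `[-1, 1]%classic) (fun=> @segment_compact R (-1) 1).
apply: subclosed_compact resolutions_closed box _ => z [[qO _ _] _ x1 _ _] [[a n]|[T n]] /=.
  rewrite in_itv /=; apply: (@sqr_le_sum (frame_of z a)).
  by under eq_bigr do rewrite expr2; rewrite qO eqxx.
by rewrite in_itv /=; apply: (@sqr_le_sum (vectors_of z T)).
Qed.

Lemma sq_nonzero (z : resolutions) (T : nset d) :
  exists2 n, n \in \val T & vectors_of (\val z) T n ^+ 2 != 0.
Proof.
have Z := set_valP z; apply: contrapT => h.
have := oner_neq0 R; rewrite -(resolution_sumT T Z) big1 ?eqxx // => n nT.
by apply: contrapT => /eqP un; apply: h; exists n.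
Qed.

Definition squares (z : resolutions) : Wspace R d :=
  fun T => mkprojW (sq_nonzero z T).

Lemma squares_Bset (z : resolutions) : Bset lam (squares z).
Proof.
have [_ _ _ _ xB] := set_valP z; split=> [T S TS i j iT jT|S i j iS jS].
  have [r _ e] := mkprojW_coord (sq_nonzero z T).
  have [s _ f] := mkprojW_coord (sq_nonzero z S).
  have := fintype.subsetP TS; rewrite !e // => TS'; rewrite !f ?TS' //.
  have com (c y t : R) : c * (r * y) * (s * t) = r * s * (c * y * t) by ring.
  by rewrite !com xB.
have [s _ f] := mkprojW_coord (sq_nonzero z S).
by rewrite !f // mulrACA -expr2 mulr_ge0 ?sqr_ge0 // mulr_ge0 ?sqr_ge0.
Qed.

Definition res_B (z : resolutions) : Bset lam := @exist _ (fun w => w \in Bset lam) (squares z) (mem_set (squares_Bset z)).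

Definition res_J (z : resolutions) : Jbar lam :=
  @exist _ (fun J => J \in Jbar lam) _ (mem_set (jac_Jbar (let: And5 fq _ _ _ _ := set_valP z in fq))).

Lemma res_J_val (z : resolutions) a b : \val (res_J z) a b = jac lam (frame_of (\val z)) a b.
Proof. by rewrite mxE. Qed.

Lemma res_J_continuous : continuous res_J.
Proof.
apply: continuous_comp_initial; apply: continuous_mx => a b.
under eq_fun do rewrite /= mxE.
move=> z; apply: (@continuous_comp _ _ _ (\val : resolutions -> _)
  (fun z => jac lam (frame_of z) a b)).
  exact: initial_continuous.
exact: jac_continuous.
Qed.

Lemma res_B_continuous : continuous res_B.
Proof.
apply: continuous_comp_initial; apply: continuous_prod => T z.
have cv : continuous (fun z : resolutions => mkvec (sq_nonzero z T) : nzvec R (\val T)).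
  apply: continuous_comp_initial; apply: continuous_prod => n {}z /=.
  apply: (@continuous_comp _ _ _ (\val : resolutions -> _)
    (fun z => vectors_of z T (\val n) ^+ 2)); first exact: initial_continuous.
  by apply: continuous_sqr; exact: vectors_of_continuous.
have cpi := @pi_continuous _ {eq_quot scal_equiv R (\val T)}%qT.
exact: (continuous_comp (cv z) (cpi _)).
Qed.

Lemma Bset_hausdorff : hausdorff_space (Bset lam).
Proof.
have hW : hausdorff_space (Wspace R d).
  by apply: hausdorff_product => T; exact: projW_hausdorff.
move=> p q cl; apply: val_inj; apply: hW => A B Ap Bq.
have c := @initial_continuous (Bset lam) (Wspace R d) set_val.
by have [x [Ax Bx]] := cl _ _ (c p _ Ap) (c q _ Bq); exists (\val x).
Qed.

Lemma Jbar_hausdorff : hausdorff_space (Jbar lam).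
Proof.
apply: (@separated_hausdorff R) => p q pq.
have [i [j ij]] : exists i j, \val p i j <> \val q i j.
  apply: contrapT => h; apply: pq; apply: val_inj; apply/matrixP => i j.
  by apply: contrapT => ij; apply: h; exists i, j.
exists (fun M : Jbar lam => \val M i j) => // M.
apply: (@continuous_comp _ _ _ (\val : Jbar lam -> _) (fun N : 'M[R]_d => N i j)).
  exact: initial_continuous.
exact: coord_continuous.
Qed.

Lemma res_B_J (z z' : resolutions) : res_B z = res_B z' -> res_J z = res_J z'.
Proof.
move=> e; have Z := set_valP z; have Z' := set_valP z'.
apply: val_inj; apply/matrixP => a b; rewrite !res_J_val.
apply: (resolution_jac lam_inj Z Z') => T n.
case: (boolP (n \in \val T)) => nT; last first.
  by case: Z Z' => _ x0 _ _ _ [_ x0' _ _ _]; rewrite x0 // x0'.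
have eT : squares z T = squares z' T by have := congr1 \val e => /= ->.
by apply: (mkprojW_inj_sum eT) => //; apply: resolution_sumT; eassumption.
Qed.

Lemma res_J_B (z z' : resolutions) : res_J z = res_J z' -> res_B z = res_B z'.
Proof.
move=> e; have Z := set_valP z; have Z' := set_valP z'.
have xx := resolution_sq lam_inj Z Z'.
apply: val_inj; apply: functional_extensionality_dep => T.
apply: mkprojW_eq => i j iT jT.
have [r _ f] := mkprojW_coord (sq_nonzero z' T); rewrite !f // !xx; first by ring.
1,2: by move=> a b; rewrite -!res_J_val e.
Qed.

Definition res_pack q (x : nset d -> 'I_d -> R) : res_ambient :=
  fun i => match i with inl (a, n) => q a n | inr (T, n) => x T n end.

Lemma res_packP q x : resolution lam q x -> res_pack q x \in resolutions.
Proof. by move=> Z; apply/mem_set. Qed.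

Lemma res_J_surj (J : Jbar lam) : exists z : resolutions, res_J z = J.
Proof.
have [q fq qJ] := Jbar_frame lam_inj (set_valP J).
have [x [Z _]] := resolution_exists lam_inj fq.
exists (@exist _ (fun z => z \in resolutions) _ (res_packP Z)); apply: val_inj; apply/matrixP => a b.
by rewrite res_J_val -qJ.
Qed.

End ResolutionSpace.

(** * Orthonormal polynomials of one block *)

Section OrthogonalPolynomials.
Variables (R : realType) (d : nat) (lam : 'I_d -> R).
Hypothesis lam_inj : injective lam.
Variables (S : {set 'I_d}) (v : 'I_d -> R).
Hypothesis v_gt0 : forall n, n \in S -> 0 < v n.

Implicit Types p q r : {poly R}.
Local Notation P := (orthop lam S v).
Local Notation "<| p , q |>" := (inner lam S v p q) (at level 0).

Lemma innerC p q : <|p, q|> = <|q, p|>.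
Proof. by apply: eq_bigr => n _; rewrite mulrAC. Qed.

Lemma innerDr p q r : <|p, q + r|> = <|p, q|> + <|p, r|>.
Proof. by rewrite -big_split; apply: eq_bigr => n _; rewrite hornerD mulrDr. Qed.

Lemma innerZr p c q : <|p, c%:P * q|> = c * <|p, q|>.
Proof. by rewrite mulr_sumr; apply: eq_bigr => n _; rewrite hornerM hornerC mulrCA. Qed.

Lemma innerX p q : <|'X * p, q|> = <|p, 'X * q|>.
Proof. by apply: eq_bigr => n _; rewrite !hornerM hornerX; ring. Qed.

Lemma inner_ge0 p : 0 <= <|p, p|>.
Proof.
by apply: sumr_ge0 => n nS; rewrite -mulrA -expr2 mulr_ge0 ?sqr_ge0 // ltW ?v_gt0.
Qed.

(** A non-zero polynomial with at most #|S| coefficients cannot vanish at all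
    the nodes of S. *)
Lemma inner_gt0 p : p != 0 -> (size p <= #|S|)%N -> 0 < <|p, p|>.
Proof.
move=> p0 sp; rewrite lt_neqAle inner_ge0 andbT eq_sym; apply: contraTneq sp => pp.
have rp n : n \in S -> root p (lam n).
  move=> nS; have := pp; rewrite /inner => /eqP; rewrite psumr_eq0 => [/allP/(_ n)|m mS].
    by rewrite mem_index_enum nS /= !mulf_eq0 -orbA orbb gt_eqF ?v_gt0 // => /(_ isT).
  by rewrite -mulrA -expr2 mulr_ge0 ?sqr_ge0 // ltW ?v_gt0.
rewrite -ltnNge cardE -(size_map lam); apply: max_poly_roots => //.
  by apply/allP => _ /mapP[n nS ->]; apply: rp; rewrite mem_enum in nS.
by rewrite map_inj_uniq ?enum_uniq.
Qed.

Lemma acoef_evenE p q : acoef_even lam S v p q ^+ 2 = <|p, p|> / <|q, q|>.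
Proof. by rewrite sqr_sqrtr // mulr_ge0 ?invr_ge0 ?inner_ge0. Qed.

Lemma orthopSS n : P n.+2 = ('X - (acoef_odd lam S v (P n.+1))%:P) * P n.+1
  - (acoef_even lam S v (P n.+1) (P n) ^+ 2)%:P * P n.
Proof. by []. Qed.

Lemma orthop_mulX n : 'X * P n =
  P n.+1 + (acoef_odd lam S v (P n))%:P * P n +
  (if n is n'.+1 then <|P n, P n|> / <|P n', P n'|> else 0)%:P * P n.-1.
Proof.
case: n => [|n]; first by rewrite /= polyC0 mul0r addr0 !mulr1 subrK.
rewrite -acoef_evenE orthopSS; set a := (acoef_odd _ _ _ _)%:P; set b := (_ ^+ 2)%:P.
by rewrite [P n.+2.-1]/=; ring.
Qed.

Lemma orthop_monic n : P n \is monic /\ size (P n) = n.+1.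
Proof.
suff: (P n \is monic /\ size (P n) = n.+1) /\ (P n.+1 \is monic /\ size (P n.+1) = n.+2).
  by case.
elim: n => [|n [IH1 [m2 s2]]].
  by rewrite [P 0]/= [P 1]/= monic1 size_poly1 monicXsubC size_XsubC.
split=> //; rewrite orthopSS; set a := acoef_odd _ _ _ _; set b := _ ^+ 2.
have mA : ('X - a%:P) * P n.+1 \is monic by rewrite monicMl ?monicXsubC.
have sA : size (('X - a%:P) * P n.+1) = n.+3.
  by rewrite size_monicM ?monicXsubC ?monic_neq0 // size_XsubC s2.
have sB : (size (- (b%:P * P n))%R < size (('X - a%:P) * P n.+1)%R)%N.
  rewrite size_polyN sA mul_polyC; apply: leq_ltn_trans (size_scale_leq _ _) _.
  by case: IH1 => _ ->.
by rewrite monicE lead_coefDl // size_polyDl // sA -monicE.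
Qed.

Lemma orthop_gt0 n : (n < #|S|)%N -> 0 < <|P n, P n|>.
Proof. by move=> nS; have [m s] := orthop_monic n; apply: inner_gt0; rewrite ?monic_neq0 ?s. Qed.

(** The coefficients of the recurrence make P_(n+1) orthogonal to P_n and
    P_(n-1); for i < n - 1 one moves the factor X to the other side, where
    X P_i involves only indices smaller than n. *)
Lemma orthop_orthogonal n : (n < #|S|)%N -> forall i j, (i < j <= n)%N -> <|P j, P i|> = 0.
Proof.
elim: n => [|n IH] nS i j /andP[ij jn]; first by lia.
have {}IH := IH (ltnW nS).
have O k l : (k <= n)%N -> (l <= n)%N -> k != l -> <|P k, P l|> = 0.
  move=> kn ln; rewrite neq_ltn => /orP[] kl; last by apply: IH; rewrite kl.
  by rewrite innerC IH // kl.
have OX k l : (l < k <= n)%N -> <|P k, 'X * P l|> = (k == l.+1)%:R * <|P k, P k|>.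
  move=> /andP[lk kn]; rewrite orthop_mulX !innerDr !innerZr (O k l); try lia.
  rewrite (O k l.-1) ?mulr0 ?addr0; try lia.
  by case: eqP => [->|kl]; rewrite ?mul1r // O ?mul0r //; lia.
move: jn; rewrite leq_eqVlt => /orP[/eqP jn|]; last by move=> jn; apply: IH; rewrite ij.
subst j; have nn0 k : (k <= n)%N -> <|P k, P k|> != 0.
  by move=> kn; rewrite gt_eqF // orthop_gt0 //; lia.
have PE : P n.+1 = 'X * P n + (- acoef_odd lam S v (P n))%:P * P n +
  (- if n is n'.+1 then <|P n, P n|> / <|P n', P n'|> else 0)%:P * P n.-1.
  by rewrite orthop_mulX !polyCN; ring.
rewrite innerC PE !innerDr !innerZr innerC innerX.
move: ij; rewrite ltnS leq_eqVlt => /orP[/eqP ->|lt_in].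
  rewrite /acoef_odd; have := nn0 n (leqnn n) => nn.
  case: n {PE IH OX nn0 nS} nn O => [|n] nn O; first by rewrite oppr0 mul0r addr0; field.
  by rewrite -[n.+1.-1]/n (O n.+1 n) ?mulr0 ?addr0; [field|lia..].
rewrite OX ?lt_in ?leqnn // (O i n) ?mulr0 ?addr0; [|lia..].
case: n nn0 O OX {PE IH nS} lt_in => [//|n] nn0 O OX; rewrite ltnS leq_eqVlt /=.
case: eqP => [->|/eqP ni] /= lt_in; first by rewrite eqxx mul1r; field; apply: nn0.
by rewrite (O i n) ?mulr0 ?addr0 //; try lia; rewrite eqSS eq_sym (negPf ni) mul0r.
Qed.

(** Multiplying by the square root of the mass turns orthogonality for the
    weighted inner product into orthogonality of functions on the index set. *)
Definition orthonormal_fun (i : nat) (n : 'I_d) : R :=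
  if n \in S then Num.sqrt (v n) * (P i).[lam n] / Num.sqrt <|P i, P i|> else 0.

Lemma sum_orthonormal_fun i j (p : {poly R}) :
  \sum_n p.[lam n] * (orthonormal_fun i n * orthonormal_fun j n) =
  <|P i, p * P j|> / (Num.sqrt <|P i, P i|> * Num.sqrt <|P j, P j|>).
Proof.
rewrite mulr_suml [LHS](bigID (mem S)) /= [X in _ + X]big1 ?addr0; last first.
  by move=> n nS; rewrite /orthonormal_fun (negPf nS) mul0r mulr0.
apply: eq_bigr => n nS; rewrite /orthonormal_fun nS hornerM invfM.
rewrite -{3}[v n]sqr_sqrtr ?ltW ?v_gt0 //; ring.
Qed.

Lemma orthonormal_fun_orthonormal i j : (i < #|S|)%N -> (j < #|S|)%N ->
  \sum_n orthonormal_fun i n * orthonormal_fun j n = (i == j)%:R.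
Proof.
move=> iS jS; have := sum_orthonormal_fun i j 1; under eq_bigr do rewrite hornerC mul1r.
move=> ->; rewrite mul1r; case: (ltngtP i j) => ij.
- by rewrite innerC (@orthop_orthogonal j) ?mul0r // ij /=.
- by rewrite (@orthop_orthogonal i) ?mul0r // ij /=.
- by rewrite ij -expr2 sqr_sqrtr ?inner_ge0 // divff // gt_eqF ?orthop_gt0.
Qed.

Lemma inner_mulX_gap i j : (i < j < #|S|)%N ->
  <|P j, 'X * P i|> = (j == i.+1)%:R * <|P j, P j|>.
Proof.
move=> /andP[ij jS]; rewrite orthop_mulX !innerDr !innerZr.
have O k : (k < j)%N -> <|P j, P k|> = 0.
  by move=> kj; apply: (@orthop_orthogonal j) => //; rewrite kj /=.
rewrite (O i) // (O i.-1) ?mulr0 ?addr0; last by lia.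
by case: eqP => [->|ji]; rewrite ?mul1r // O ?mul0r //; lia.
Qed.

Lemma jacobi_even_frac j i : (i < #|S|)%N -> (j < #|S|)%N ->
  <|P j, P j|> / (Num.sqrt <|P i, P i|> * Num.sqrt <|P j, P j|>) =
  acoef_even lam S v (P j) (P i).
Proof.
move=> iS jS; rewrite /acoef_even sqrtrM ?inner_ge0 // sqrtrV ?inner_ge0 //.
rewrite -{1}[<|P j, P j|>]sqr_sqrtr ?inner_ge0 //.
have h k : (k < #|S|)%N -> Num.sqrt <|P k, P k|> != 0.
  by move=> kS; rewrite gt_eqF // sqrtr_gt0 orthop_gt0.
by field; rewrite !h.
Qed.

Lemma orthonormal_fun_jacobi (i j : 'I_#|S|) :
  \sum_n lam n * (orthonormal_fun i n * orthonormal_fun j n) = jacobi_mx lam S v i j.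
Proof.
have := sum_orthonormal_fun i j 'X; under eq_bigr do rewrite hornerX.
move=> ->; rewrite mxE; case: (eqVneq i j) => [->|].
  by rewrite -expr2 sqr_sqrtr ?inner_ge0.
rewrite -val_eqE /= neq_ltn => /orP[] ij.
  rewrite -innerX innerC inner_mulX_gap ?ij ?ltn_ord //.
  case: (eqVneq (j : nat) i.+1) => [ji|_].
    by rewrite mul1r jacobi_even_frac // /jacobi_even ji.
  by rewrite !mul0r ifN // neq_ltn; apply/orP; left; lia.
rewrite inner_mulX_gap ?ij ?ltn_ord //.
case: (eqVneq (j : nat) i.+1) => [ji|_]; first by rewrite ji ltnNge leqnSn in ij.
case: (eqVneq (i : nat) j.+1) => [ij1|_]; last by rewrite !mul0r.
by rewrite mul1r [X in _ / X]mulrC jacobi_even_frac // /jacobi_even ij1.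
Qed.

Lemma orthonormal_fun0 n : n \in S -> orthonormal_fun 0 n ^+ 2 = v n / <|1, 1|>.
Proof.
move=> nS; rewrite /orthonormal_fun nS /= hornerC mulr1 exprMn exprVn.
by rewrite !sqr_sqrtr ?inner_ge0 // ltW ?v_gt0.
Qed.

End OrthogonalPolynomials.

(** * Frames assembled from the blocks of an ordered partition *)

Section BlockFrame.
Variables (R : realType) (d : nat) (lam : 'I_d -> R).
Hypothesis lam_inj : injective lam.
Variables (P : ordpart d) (v : 'I_(npart P) -> 'I_d -> R).
Hypothesis v_gt0 : forall k n, n \in P k -> 0 < v k n.

Definition block_index (a : 'I_d) : {k : 'I_(npart P) & 'I_#|P k|} :=
  tagnat.sig (cast_ord (esym (ordpart_card P)) a).

Definition block_pos (k : 'I_(npart P)) (i : 'I_#|P k|) : 'I_d :=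
  cast_ord (ordpart_card P) (tagnat.Rank k i).

Definition block_frame (a n : 'I_d) : R :=
  let s := block_index a in orthonormal_fun lam (P (tag s)) (v (tag s)) (tagged s) n.

Lemma block_posP a : exists k i, a = @block_pos k i.
Proof.
exists (tag (block_index a)), (tagged (block_index a)); rewrite /block_pos -tagnat.rankE.
by rewrite /block_index tagnat.sigK cast_ordKV.
Qed.

Lemma block_frameE k (i : 'I_#|P k|) n :
  block_frame (block_pos i) n = orthonormal_fun lam (P k) (v k) i n.
Proof.
by rewrite /block_frame /block_index /block_pos cast_ordK /tagnat.Rank tagnat.rankK.
Qed.

Lemma block_posE k (i : 'I_#|P k|) :
  block_pos i = (\sum_(l < npart P | (l < k)%N) #|P l| + i)%N :> nat.
Proof. exact: tagnat.RankEsum. Qed.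

Lemma block_pos_eq k l (i : 'I_#|P k|) (j : 'I_#|P l|) :
  (block_pos i == block_pos j) = (k == l) && (i == j :> nat).
Proof. exact: tagnat.eq_Rank. Qed.

Lemma block_pos_same k (i j : 'I_#|P k|) : (block_pos i < block_pos j)%N = (i < j)%N.
Proof. by rewrite !block_posE ltn_add2l. Qed.

Lemma block_pos_diff k l (i : 'I_#|P k|) (j : 'I_#|P l|) : (k < l)%N ->
  (block_pos i < block_pos j)%N.
Proof.
move=> kl; rewrite !block_posE [ltnRHS](_ : _ =
  \sum_(m < npart P | (m < k)%N) #|P m| + \sum_(m < npart P | (k <= m < l)%N) #|P m| + j)%N.
  rewrite -addnA ltn_add2l ltn_addr // (bigD1 k) ?leqnn //=.
  by rewrite ltn_addr.
congr (_ + _)%N; rewrite (bigID (fun m : 'I__ => (m < k)%N)) /=.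
congr (_ + _)%N; apply: eq_bigl => m; last by rewrite -leqNgt andbC.
by apply/andP/idP => [[]//|mk]; rewrite (ltn_trans mk).
Qed.

Lemma part_eq k l n : n \in P k -> n \in P l -> k = l.
Proof.
move=> nk nl; apply: contraTeq nl => /part_disjoint kl.
by rewrite (disjointFr kl).
Qed.

Lemma orthonormal_fun_out k i n : n \notin P k -> orthonormal_fun lam (P k) (v k) i n = 0.
Proof. by rewrite /orthonormal_fun => /negPf ->. Qed.

Lemma orthonormal_fun_disjoint k l i j n : k != l ->
  orthonormal_fun lam (P k) (v k) i n * orthonormal_fun lam (P l) (v l) j n = 0.
Proof.
move=> kl; case: (boolP (n \in P k)) => nk; last by rewrite (orthonormal_fun_out _ nk) mul0r.
by rewrite [X in _ * X]orthonormal_fun_out ?mulr0 //; apply: contra kl => /(part_eq nk) ->.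
Qed.

Lemma jac_same k (i j : 'I_#|P k|) :
  jac lam block_frame (block_pos i) (block_pos j) = jacobi_mx lam (P k) (v k) i j.
Proof.
rewrite -(orthonormal_fun_jacobi lam_inj (@v_gt0 k)).
by apply: eq_bigr => n _; rewrite !block_frameE.
Qed.

Lemma jac_diff k l (i : 'I_#|P k|) (j : 'I_#|P l|) : k != l ->
  jac lam block_frame (block_pos i) (block_pos j) = 0.
Proof.
move=> kl; apply: big1 => n _.
by rewrite !block_frameE orthonormal_fun_disjoint ?mulr0.
Qed.

Lemma jacobi_even_ge0 (S : {set 'I_d}) u n : 0 <= jacobi_even lam S u n.
Proof. exact: sqrtr_ge0. Qed.

Lemma block_frame_frame : frame lam block_frame.
Proof.
split=> a b; have [k [i ->]] := block_posP a; have [l [j ->]] := block_posP b.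
- case: (eqVneq k l) => [kl|kl].
    subst l; under eq_bigr do rewrite !block_frameE.
    rewrite (orthonormal_fun_orthonormal lam_inj (@v_gt0 k)) //.
    by rewrite block_pos_eq eqxx.
  under eq_bigr do rewrite !block_frameE orthonormal_fun_disjoint //.
  by rewrite sumr_const mul0rn block_pos_eq (negPf kl).
- case: (eqVneq k l) => [kl|kl]; last by rewrite jac_diff.
  subst l; rewrite jac_same mxE !block_posE -addnS ltn_add2l => ij.
  have ij' := ltn_trans (ltnSn i) ij.
  by rewrite -val_eqE (ltn_eqF ij') (gtn_eqF ij) (ltn_eqF (ltn_trans ij' (ltnSn j))).
- case: (eqVneq k l) => [kl|kl]; last by rewrite jac_diff.
  subst l; rewrite jac_same mxE !block_posE -addnS => /addnI ij.
  by rewrite -val_eqE /= ij ltn_eqF // eqxx jacobi_even_ge0.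
Qed.

Lemma part_card_gt0 k : (0 < #|P k|)%N.
Proof. by rewrite card_gt0 part_neq0. Qed.

Lemma block_start_neq0 k n (i : 'I_#|P k|) : n \in P k -> i = 0%N :> nat ->
  block_frame (block_pos i) n != 0.
Proof.
move=> nk i0; rewrite block_frameE i0 -sqrf_eq0 orthonormal_fun0 //; last exact: v_gt0.
rewrite mulf_neq0 ?invr_eq0 ?gt_eqF ?v_gt0 //.
by apply: (orthop_gt0 lam_inj (@v_gt0 k) (part_card_gt0 k)).
Qed.

(** On the part P k, the constant polynomial gives a row without zeros, so
    only the first row of a block can be the leading row of T. *)
Lemma block_leads T a : leads block_frame T a -> exists k : 'I_(npart P),
  [/\ tail block_frame a = [set n | [forall l : 'I_(npart P), (l < k)%N ==> (n \notin P l)]]%SET,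
      forall n, n \notin P k -> block_frame a n = 0 &
      exists2 c, c != 0 & forall n, n \in P k -> block_frame a n ^+ 2 = c * v k n].
Proof.
have [k [i ->]] := block_posP a => -[[n nT qn] /fintype.subsetP tT]; exists k.
have nk : n \in P k.
  by apply: contraNT qn => nk; rewrite block_frameE orthonormal_fun_out.
(* First row of the block l, which has no zero on P l. *)
pose i0 l : 'I_#|P l| := Ordinal (part_card_gt0 l).
have i_eq0 : i = 0%N :> nat.
  apply/eqP; rewrite -leqn0 leqNgt -(block_pos_same (i0 k) i); apply/negP => lt_i.
  by have := tailP _ _ _ (tT n nT) _ lt_i => /eqP; rewrite (negPf (block_start_neq0 _ _)).
split.
- apply/finset.setP => m; rewrite [RHS]inE; apply/tailP/forallP => h.
    move=> l; apply/implyP => lk; apply/negP => ml.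
    have /eqP := h (block_pos (i0 l)) (block_pos_diff _ _ lk).
    by rewrite (negPf (block_start_neq0 _ _)).
  move=> b; have [l [j ->]] := block_posP b => ji; rewrite block_frameE orthonormal_fun_out //.
  case: (ltngtP l k) => lk; first by have /implyP/(_ lk) := h l.
    by move: ji; rewrite ltnNge ltnW // block_pos_diff.
  by move/val_inj: lk => lk; subst l; move: ji; rewrite block_pos_same i_eq0.
- by move=> m mk; rewrite block_frameE orthonormal_fun_out.
exists (inner lam (P k) (v k) 1 1)^-1.
  rewrite invr_eq0 gt_eqF //.
  exact: (orthop_gt0 lam_inj (@v_gt0 k) (part_card_gt0 k)).
by move=> m mk; rewrite block_frameE i_eq0 (orthonormal_fun0 lam (@v_gt0 k) mk) mulrC.
Qed.

End BlockFrame.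

(** * Lifting a point of B to a resolution *)

Section Main.
Variables (R : realType) (d : nat) (lam : 'I_d -> R).
Hypothesis lam_inj : injective lam.

Lemma projW_pos_rep (S : {set 'I_d}) (w : projW_pos R S) : S != finset.set0 ->
  exists2 c, c != 0 & forall n, n \in S -> 0 < c * hcoord (\val w) n.
Proof.
move=> /finset.set0Pn[m mS]; have wp := set_valP w; exists (hcoord (\val w) m).
  by have := wp m m mS mS; apply: contraTneq => ->; rewrite mul0r ltxx.
by move=> n nS; exact: wp.
Qed.

(** The factor c k makes the homogeneous coordinates positive, as
    required for their square roots; fbar is insensitive to it. *)
Lemma fbar_frame (x : Dbar R d) (c : 'I_(npart (projT1 x)) -> R) :
  (forall k, c k != 0) ->
  (forall k n, n \in projT1 x k -> 0 < c k * hcoord (\val (projT2 x k)) n) ->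
  forall a b, fbar lam x a b =
    jac lam (block_frame lam (fun k n => c k * hcoord (\val (projT2 x k)) n)) a b.
Proof.
case: x c => P y c c0 cpos a b /=; rewrite /fbar /= castmxE.
have [k [i ->]] := block_posP P a; have [l [j ->]] := block_posP P b.
rewrite [in LHS]/block_pos !cast_ordK.
case: (eqVneq k l) => [kl|kl].
  subst l; rewrite jac_same // jacobi_mx_scale //.
  have /matrixP/(_ i j) := submxblock_diag (fun k => Defs.fmap lam (y k)) k.
  by rewrite mxE.
rewrite jac_diff //.
have /matrixP/(_ i j) := mxblockK (fun j0 k0 : 'I_(npart P) =>
  if j0 == k0 then conform_mx 0 (Defs.fmap lam (y j0)) else 0 : 'M[R]_(#|P j0|, #|P k0|)) k l.
by rewrite mxE (negPf kl) [X in _ = X -> _]mxE => h; exact: h.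
Qed.

Section Lift.
Variables (w : Wspace R d) (Bw : Bset lam w).

Lemma Kset_part (k : 'I_(size (phi_chain w))) n :
  (n \in \val (Kset k)) = [forall l : 'I_(size (phi_chain w)), (l < k)%N ==> (n \notin Kpart l)].
Proof.
have /finset.bigcupP[l _ nl] : n \in (\bigcup_(k < size (phi_chain w)) Kpart k)%SET.
  by rewrite (Kpart_cover lam_inj Bw) inE.
have phin : phi w n = Kset l by move: (nl); rewrite (Kpart_mem lam_inj Bw) => /eqP.
have nKl : n \in \val (Kset l) by rewrite -phin mem_phi.
case: (ltnP l k) => [lk|kl].
  have /mem_phi_chain[m em] := Kset_mem k.
  transitivity false; last by apply/esym/forallP => /(_ l); rewrite lk nl.
  apply: contraTF (phi_chain_proper lam_inj Bw lk) => nk.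
  rewrite properE negb_and negbK; apply/orP; right.
  by rewrite -phin em (phi_sub lam_inj Bw) // -em.
transitivity true; last first.
  apply/esym/forallP => l'; apply/implyP => l'k; apply: contraTN nl => nl'.
  have ne : l' != l by rewrite -val_eqE ltn_eqF // (leq_trans l'k).
  by rewrite (disjointFr (Kpart_disjoint lam_inj Bw ne) nl').
move: kl; rewrite leq_eqVlt => /orP[/eqP/val_inj -> //|kl].
exact: fintype.subsetP (fintype.proper_sub (phi_chain_proper lam_inj Bw kl)) _ nKl.
Qed.

(** Such an index has phi equal to a smaller set of the chain, so a non-zero
    coordinate at K_k would contradict the maximality defining phi. *)
Lemma Kset_out (k : 'I_(size (phi_chain w))) n :
  n \in \val (Kset k) -> n \notin Kpart k -> hcoord (w (Kset k)) n = 0.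
Proof.
move=> nk nkk; have /finset.bigcupP[l _ nl] : n \in (\bigcup_(k < size (phi_chain w)) Kpart k)%SET.
  by rewrite (Kpart_cover lam_inj Bw) inE.
have phin : phi w n = Kset l by move: (nl); rewrite (Kpart_mem lam_inj Bw) => /eqP.
apply/eqP; apply: contraNT nkk => wn.
have sub : \val (Kset k) \subset \val (phi w n).
  by apply: (is_phi_sub lam_inj Bw (phiP w n)).
case: (ltngtP k l) => [kl|lk|/val_inj -> //].
  by have := phi_chain_proper lam_inj Bw kl; rewrite -phin properE sub andbF.
have := nk; rewrite Kset_part => /forallP/(_ l); rewrite lk /= => /negP; case.
exact: nl.
Qed.

End Lift.

Lemma pimap_frame (w : Bset lam) :
  exists q, [/\ frame lam q, forall a b, fbar lam (pimap lam_inj w) a b = jac lam q a b &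
    forall (T : nset d) a, leads q (\val T) a -> exists2 K : nset d, \val K = tail q a &
      forall i j, i \in \val K -> j \in \val K ->
        hcoord (\val w K) i * q a j ^+ 2 = hcoord (\val w K) j * q a i ^+ 2].
Proof.
pose Bw := set_valP w; set x := pimap lam_inj w.
have H k : exists c, c != 0 /\
    forall n, n \in projT1 x k -> 0 < c * hcoord (\val (projT2 x k)) n.
  by have [c c0 cP] := projW_pos_rep (projT2 x k) (part_neq0 k); exists c.
have [c cP] := boolp.choice H.
have c0 k : c k != 0 by case: (cP k).
have cpos k n : n \in projT1 x k -> 0 < c k * hcoord (\val (projT2 x k)) n.
  by case: (cP k) => _; apply.
exists (block_frame lam (fun k n => c k * hcoord (\val (projT2 x k)) n)); split.
- exact: block_frame_frame.
- exact: fbar_frame.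
move=> T a /(block_leads lam_inj cpos)[k [tE out [e e0 sqE]]].
exists (Kset k) => [|i j iK jK].
  by rewrite tE; apply/finset.setP => n; rewrite inE (Kset_part Bw).
case: (boolP (i \in Kpart k)) => ik; last first.
  by rewrite (Kset_out Bw iK ik) [in RHS]out // expr0n mul0r mulr0.
case: (boolP (j \in Kpart k)) => jk; last first.
  by rewrite (Kset_out Bw jK jk) [in LHS]out // expr0n mul0r mulr0.
have [r r0 hE] := mkprojW_coord (Kpart_nz lam_inj Bw k).
have hE' n : n \in Kpart k -> hcoord (\val (projT2 x k)) n = r * hcoord (\val w (Kset k)) n.
  exact: hE.
by rewrite !sqE // !hE' //; ring.
Qed.

(** The resolution extending the frame of pi(w) reproduces w: on the tail K of
    the leading row of T the squares q_a^2 are proportional to w^K, and the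
    equation of B for T in K turns w^K into w^T in the same way as the square
    of the annihilating polynomial turns q_a^2 into the squares of x^T. *)
Lemma pimap_resolution (w : Bset lam) :
  exists2 z : resolutions lam, res_B z = w &
    \val (res_J z) = fbar lam (pimap lam_inj w).
Proof.
have [q [fq qJ qK]] := pimap_frame w; have [Bw _] := set_valP w.
have [x [Z xE]] := resolution_exists lam_inj fq.
exists (@exist _ (fun z => z \in resolutions lam) _ (res_packP Z)); last first.
  by apply/matrixP => a b; rewrite mxE qJ.
apply: val_inj; apply: functional_extensionality_dep => T.
have [a la [c c0 xT]] := xE T; have [K KE prop] := qK T a la.
have [[i0 i0T qi0] TK] := la; rewrite -KE in TK.
have TK' := fintype.subsetP TK.
have H0 : hcoord (\val w K) i0 != 0.
  have [m mK Hm] := hcoord_neq0 (\val w K).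
  have : hcoord (\val w K) m * q a i0 ^+ 2 != 0 by rewrite mulf_neq0 ?expf_neq0.
  by rewrite (prop m i0 mK (TK' _ i0T)) mulf_eq0 negb_or => /andP[].
(* The proportionality factor of w^K and q_a^2. *)
have mu0 : hcoord (\val w K) i0 / q a i0 ^+ 2 != 0 by rewrite mulf_neq0 ?invr_eq0 ?expf_neq0.
have HE j : j \in \val K -> hcoord (\val w K) j = hcoord (\val w K) i0 / q a i0 ^+ 2 * q a j ^+ 2.
  by move=> jK; rewrite mulrAC (prop i0 j (TK' _ i0T) jK) mulfK // expf_neq0.
apply: mkprojW_eq => i j iT jT /=; apply: (mulfI mu0).
have := Bw T K TK i j iT jT; rewrite (HE i (TK' _ iT)) (HE j (TK' _ jT)).
rewrite /vectors_of /= !xT /annihilate !exprMn !sqr_prod_Ccoef -KE; set mu := _ / _ => e.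
transitivity (c ^+ 2 * (Ccoef lam (\val K :\: \val T) i * hcoord (\val w T) j * (mu * q a i ^+ 2))).
  by ring.
by rewrite e; ring.
Qed.

End Main.

Theorem theorem20 (R : realType) (d : nat) (d_gt0 : (0 < d)%N)
    (lam : 'I_d -> R) (lam_inj : injective lam) :
  exists F : Bset lam -> Jbar lam,
    (forall w : Bset lam, \val (F w) = fbar lam (pimap lam_inj w)) /\
    homeomorphism F.
Proof.
have H (w : Bset lam) : exists J : Jbar lam, \val J = fbar lam (pimap lam_inj w).
  by have [z _ <-] := pimap_resolution lam_inj w; exists (res_J z).
have [F FE] := boolp.choice H; exists F; split=> //.
apply: (homeomorphism_factor (al := @res_B R d lam) (be := @res_J R d lam)).
- exact: compact_set_type (@resolutions_compact _ _ lam).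
- exact: Bset_hausdorff.
- exact: Jbar_hausdorff.
- exact: res_B_continuous.
- exact: res_J_continuous.
- by move=> w; have [z zw _] := pimap_resolution lam_inj w; exists z.
- exact: res_J_surj.
- exact: res_J_B.
move=> z; have [z' zz' Jz'] := pimap_resolution lam_inj (res_B z).
by apply: val_inj; rewrite FE -Jz' (res_B_J lam_inj zz').
Qed.
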